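(* Let $G_3(\alpha,\beta)=(\alpha^2+\beta^2+6\alpha\beta)^2-16\alpha\beta\left(4(1+\alpha\beta)-3(\alpha+\beta)\right)^2$. Then for all $p\in\mathbb{C}$ with $0<|p|$ sufficiently small, \[\mathrm{m}\!\left(G_3\!\left(\frac{(x+x^{-1})^2(y+y^{-1})^2}{16},\ \frac1p\left(\frac{1+2p}{2+p}\right)^3\right)\right)=-16\log 2-16\,\mu\!\left(p\left(\frac{2+p}{1+2p}\right)^3\right)+8\,\mu\!\left(p^3\,\frac{2+p}{1+2p}\right).\]
   Context: $\mathrm{m}(P)=\int_0^1\int_0^1\log|P(e^{2\pi i\theta_1},e^{2\pi i\theta_2})|d\theta_1d\theta_2$ is the logarithmic Mahler measure of a Laurent polynomial in $x,y$; $\mu(t)=\mathrm{m}\!\left(\frac{4}{\sqrt t}+x+\frac1x+y+\frac1y\right)$. *)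

(* Defs.v *)
From mathcomp Require Import all_boot all_algebra.
From mathcomp Require Import all_classical all_reals all_analysis.
From mathcomp Require Export complex.
Set Implicit Arguments. Unset Strict Implicit. Unset Printing Implicit Defensive.
Import GRing.Theory Num.Theory.
Local Open Scope ring_scope.
Local Open Scope classical_set_scope.

Definition cabs (R : realType) (z : R[i]) : R := complex.Re `|z|.

Definition expi2pi (R : realType) (t : R) : R[i] :=
  (cos (2 * pi * t) +i* sin (2 * pi * t))%C.

(* logarithmic Mahler measure of a Laurent polynomial P in x, y (given by
   its evaluation function C -> C -> C):
   m(P) = int_0^1 int_0^1 log |P(e^{2 pi i t1}, e^{2 pi i t2})| dt2 dt1 *)
Definition mahler (R : realType) (P : R[i] -> R[i] -> R[i]) : \bar R :=
  (\int[lebesgue_measure]_(t1 in `[0%R, 1%R])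
     (\int[lebesgue_measure]_(t2 in `[0%R, 1%R])
        (ln (cabs (P (expi2pi t1) (expi2pi t2))))%:E))%E.

Definition mu (R : realType) (t : R[i]) : \bar R :=
  mahler (fun x y => 4 / sqrtc t + x + x^-1 + y + y^-1).

Definition G3 (R : realType) (a b : R[i]) : R[i] :=
  (a ^+ 2 + b ^+ 2 + 6 * a * b) ^+ 2
  - 16 * a * b * (4 * (1 + a * b) - 3 * (a + b)) ^+ 2.

(* Main.v *)
Require Import Defs.
From mathcomp Require Import all_boot all_order all_algebra.
From mathcomp Require Import all_classical all_reals all_analysis.
From mathcomp Require Import complex.
From mathcomp Require Import measurable_realfun.
From mathcomp Require Import ring lra zify.
Import Order.TTheory GRing.Theory Num.Theory.
Import numFieldNormedType.Exports.
Set Implicit Arguments. Unset Strict Implicit. Unset Printing Implicit Defensive.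
Local Open Scope ring_scope.
Local Open Scope classical_set_scope.

(* On the torus X = (x + 1/x)^2 (y + 1/y)^2 / 16 lies in [0, 1] and has the same moments as the square
   of Z = (x + 1/x + y + 1/y) / 4, whence mu t = log 4 - log|t| / 2 + E log|1 - t X| / 2.  Put
   B = p ((2 + p) / (1 + 2 p))^3 and A = p^3 (2 + p) / (1 + 2 p).  If A_1, ..., A_4 are the roots of
   G3 (., B), then B^4 G3 X (1/B) = prod_j (1 - A_j X), and the claim becomes
     sum_j E log|1 - A_j X| + 8 E log|1 - B X| - 4 E log|1 - A X| = 32 log|(1 + p/2) / (1 + 2 p)|.
   It holds at p = 0, so only the derivatives in p have to be compared.  They are combinations of
   the values of F t = E 1 / (1 - t X) = 2F1 (1/2, 1/2; 1; t) at A_j, B and A.  Ramanujan's cubic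
   transformation reduces these values to F B, and what is left is a rational identity between the
   roots of x^4 + 2 x^3 - 2 B x - B, which parametrize the A_j. *)

(** The term in A arises because A is itself one of the A_j. These are [al x_j] for the solutions
    x_j of [be x = B], and one solution is the image of p under the involution x -> - (2 + x) / (1 +
    2 x), which exchanges [al] and [be]. It stays near - 2, outside the disc where the cubic
    transformation is established, so F A is linked to F B through p itself: F B = (1 + 2 p) F A.
    The other three solutions tend to 0 with p and fall under the transformation directly. These
    three collide at p = 0, and no smooth dependence of the roots on p is at hand. Hence no A_j is
    ever differentiated: at each fixed p the logarithmic derivative in B is split into partial
    fractions, whose coefficients come from implicit differentiation of the modular equation. B^4 G3
    X (1/B) equals 1 at B = 0. So for small p every quantity under a logarithm is near 1 uniformly
    on the torus, and all logarithms are bounded. The derivative identities divide by p and hold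
    only for p != 0, which the criterion for constancy has to tolerate. *)

(** * Averages of bounded measurable functions over the unit square *)

Section Average.
Variable R : realType.
Notation leb := (@lebesgue_measure R).
Notation I01 := (`[0%R, 1%R]%classic : set R).

(** Boundedness is imposed on the whole plane: since the unit square has measure 1, it yields
    integrability and the bound [avg_bound] at once. *)
Definition bounded_measurable (f : R * R -> R) : Prop :=
  measurable_fun setT f /\ exists M : R, forall z, `|f z| <= M.

Definition usquare : set (R * R) := I01 `*` I01.

Definition avg (f : R * R -> R) : R := \int[(leb \x leb)%E]_(z in usquare) f z.

Notation T := (measurableTypeR R).

Lemma measurable_usquare : measurable (usquare : set (T * T)).
Proof. by apply: measurableX. Qed.
Hint Resolve measurable_usquare : core.

Lemma leb01 : leb I01 = 1%E.
Proof. by rewrite lebesgue_measure_itv/= lte_fin ltr01 sube0. Qed.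

Lemma usquare1 : (leb \x leb)%E usquare = 1%E.
Proof.
transitivity (leb I01 * leb I01)%E; first exact: product_measure1E.
by rewrite leb01 mule1.
Qed.

Lemma bm_integrable f : bounded_measurable f ->
  (leb \x leb)%E.-integrable usquare (EFin \o f).
Proof.
move=> [mf [M Mf]]; apply: measurable_bounded_integrable => //.
- by rewrite [X in (X < _)%E](_ : _ = 1%E) ?ltry//; exact: usquare1.
- exact: measurable_funTS.
- exists M; split; first exact: num_real.
  by move=> x Mx z _; apply: le_trans (Mf z) _; exact: ltW.
Qed.

Lemma avgD (f g : R * R -> R) : bounded_measurable f -> bounded_measurable g ->
  avg (fun z => f z + g z) = avg f + avg g.
Proof. by move=> /bm_integrable bf /bm_integrable bg; exact: RintegralD. Qed.

Lemma avgZ c f : bounded_measurable f -> avg (fun z => c * f z) = c * avg f.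
Proof. by move=> /bm_integrable bf; exact: RintegralZl. Qed.

Lemma avg_cst c : avg (fun=> c) = c.
Proof. 
rewrite /avg Rintegral_cst// [X in fine X](_ : _ = 1%E) ?mulr1//; exact: usquare1.
Qed.

Lemma bm_cst c : bounded_measurable (fun=> c).
Proof. by split => //; exists `|c|. Qed.

Lemma bmD (f g : R * R -> R) : bounded_measurable f -> bounded_measurable g ->
  bounded_measurable (fun z => f z + g z).
Proof.
move=> [mf [M Mf]] [mg [N Ng]]; split; first exact: measurable_funD.
by exists (M + N) => z; apply: le_trans (ler_normD _ _) _; exact: lerD.
Qed.

Lemma bmM (f g : R * R -> R) : bounded_measurable f -> bounded_measurable g ->
  bounded_measurable (fun z => f z * g z).
Proof.
move=> [mf [M Mf]] [mg [N Ng]]; split; first exact: measurable_funM.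
by exists (M * N) => z; rewrite normrM ler_pM.
Qed.

Lemma le_avg (f g : R * R -> R) : bounded_measurable f -> bounded_measurable g ->
  (forall z, f z <= g z) -> avg f <= avg g.
Proof. by move=> /bm_integrable bf /bm_integrable bg fg; exact: le_Rintegral. Qed.

Lemma avg_bound (f : R * R -> R) (M : R) : measurable_fun setT f -> (forall z, `|f z| <= M) -> `|avg f| <= M.
Proof.
move=> mf Mf; have bf : bounded_measurable f by split=> //; exists M.
rewrite ler_norml -{1}(avg_cst (- M)) -{2}(avg_cst M); apply/andP; split.
  by apply: le_avg => // [|z]; [exact: bm_cst|have := Mf z; rewrite ler_norml => /andP[]].
by apply: le_avg => // [|z]; [exact: bm_cst|have := Mf z; rewrite ler_norml => /andP[]].
Qed.

(** Fubini for the integrand extended by zero outside the square. It turns the iterated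
    extended-real integrals of [mahler] into one real number. *)
Lemma avg_iterated f : bounded_measurable f ->
  (\int[leb]_(t1 in I01) \int[leb]_(t2 in I01) (f (t1, t2))%:E = (avg f)%:E)%E.
Proof.
move=> bf; have /= intf := bm_integrable bf.
rewrite /avg /Rintegral fineK; last exact: integrable_fin_num.
rewrite [RHS]integral_mkcond/=.
rewrite -integral12_prod_meas1/=; last first.
  by move/(integrable_mkcond _ measurable_usquare) : intf.
rewrite integral_mkcond/=; apply: eq_integral => x _.
rewrite /fubini_F/= patchE; case: ifPn => xI.
  rewrite integral_mkcond; apply: eq_integral => y _.
  rewrite !patchE; have -> // : ((x, y) \in usquare) = (y \in I01).
  by rewrite /usquare in_setX/= xI.
rewrite integral0_eq// => y _; rewrite patchE; case: ifPn => //.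
by rewrite /usquare in_setX/= (negbTE xI).
Qed.

Lemma avg_prod (g h : R -> R) : measurable_fun setT g -> measurable_fun setT h ->
  (exists M : R, forall x, `|g x| <= M) -> (exists M : R, forall x, `|h x| <= M) ->
  avg (fun z => g z.1 * h z.2) = (\int[leb]_(x in I01) g x) * (\int[leb]_(x in I01) h x).
Proof.
move=> mg mh [M Mg] [N Nh].
have int1 (k : R -> R) K : measurable_fun setT k -> (forall x, `|k x| <= K) ->
    leb.-integrable I01 (EFin \o k).
  move=> mk Kk; apply: measurable_bounded_integrable => //.
  - by have := leb01; rewrite /= => ->; rewrite ltry.
  - exact: measurable_funTS.
  - exists K; split; first exact: num_real.
    by move=> x Mx z _; apply: le_trans (Kk z) _; exact: ltW.
have bf : bounded_measurable (fun z : R * R => g z.1 * h z.2).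
  split; last by exists (M * N) => z; rewrite normrM ler_pM.
  by apply: measurable_funM; exact: measurableT_comp.
apply: EFin_inj; rewrite -avg_iterated//=.
transitivity (\int[leb]_(x in I01) ((g x)%:E * (\int[leb]_(x in I01) h x)%R%:E))%E.
  apply: eq_integral => x _; rewrite [in RHS]/Rintegral fineK; last first.
    by apply: integrable_fin_num => //; exact: int1 Nh.
  rewrite -integralZl//; last exact: int1 Nh.
rewrite integralZr//=; last exact: int1 Mg.
rewrite EFinM; congr (_ * _)%E; rewrite [in RHS]/Rintegral fineK//.
by apply: integrable_fin_num => //; exact: int1 Mg.
Qed.

End Average.

(** * The complex modulus as a real number *)

Section ComplexAbs.
Variable R : realType.
Notation C := R[i].
Implicit Types (z w : C) (x y : R).

Lemma cabsE z : `|z| = (cabs z)%:C%C.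
Proof. by case: z => a b; rewrite /cabs normc_def. Qed.

Lemma cabs_ge0 z : 0 <= cabs z.
Proof. by have := normr_ge0 z; rewrite cabsE lecR. Qed.

Lemma cabsM z w : cabs (z * w) = cabs z * cabs w.
Proof. by apply: (@complexI R); rewrite -cabsE normrM !cabsE rmorphM. Qed.

Lemma cabsD z w : cabs (z + w) <= cabs z + cabs w.
Proof. by rewrite -lecR rmorphD/= -!cabsE ler_normD. Qed.

Lemma cabsN z : cabs (- z) = cabs z.
Proof. by rewrite /cabs normrN. Qed.

Lemma cabsB z w : cabs (z - w) <= cabs z + cabs w.
Proof. by rewrite -(cabsN w) cabsD. Qed.

Lemma cabs0 : cabs (0 : C) = 0.
Proof. by rewrite /cabs normr0. Qed.

Lemma cabs1 : cabs (1 : C) = 1.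
Proof. by rewrite /cabs normr1. Qed.

Lemma cabs_eq0 z : (cabs z == 0) = (z == 0).
Proof.
rewrite -[RHS]normr_eq0 cabsE -(inj_eq (@complexI R)); exact.
Qed.

Lemma cabs_gt0 z : (0 < cabs z) = (z != 0).
Proof. by rewrite lt_def cabs_eq0 cabs_ge0 andbT. Qed.

Lemma cabsV z : cabs z^-1 = (cabs z)^-1.
Proof.
have [->|z0] := eqVneq z 0; first by rewrite invr0 cabs0 invr0.
by apply: (@mulfI _ (cabs z)); rewrite ?cabs_eq0// -cabsM !divff ?cabs_eq0 ?cabs1.
Qed.

Lemma cabsX z n : cabs (z ^+ n) = cabs z ^+ n.
Proof. by elim: n => [|n IH]; rewrite ?cabs1// !exprS cabsM IH. Qed.

Lemma cabsR x : cabs x%:C%C = `|x|.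
Proof. by rewrite /cabs normc_def/= expr0n/= addr0 sqrtr_sqr. Qed.

Lemma cabs_nat n : cabs (n%:R : C) = n%:R.
Proof. by rewrite -(rmorph_nat (@real_complex R)) cabsR normr_nat. Qed.

Lemma cabs_sqr z : cabs z ^+ 2 = complex.Re z ^+ 2 + complex.Im z ^+ 2.
Proof. by rewrite /cabs normc_def/= sqr_sqrtr// addr_ge0// sqr_ge0. Qed.

Lemma le_Re_cabs z : `|complex.Re z| <= cabs z.
Proof.
by rewrite -(@ler_pXn2r _ 2)// ?nnegrE ?cabs_ge0// cabs_sqr real_normK ?num_real// lerDl sqr_ge0.
Qed.

Lemma le_Im_cabs z : `|complex.Im z| <= cabs z.
Proof.
by rewrite -(@ler_pXn2r _ 2)// ?nnegrE ?cabs_ge0// cabs_sqr real_normK ?num_real// lerDr sqr_ge0.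
Qed.

Lemma cabs_le z : cabs z <= `|complex.Re z| + `|complex.Im z|.
Proof.
rewrite -(@ler_pXn2r _ 2)// ?nnegrE ?cabs_ge0 ?addr_ge0//.
rewrite cabs_sqr sqrrD !real_normK ?num_real// -addrA lerD2l lerDr.
by rewrite mulrn_wge0// mulr_ge0.
Qed.

Lemma cabs_lower z w : cabs z - cabs w <= cabs (z + w).
Proof. by rewrite lerBlDr -{1}(addrK w z) cabsB. Qed.

Lemma Re_D z w : complex.Re (z + w) = complex.Re z + complex.Re w.
Proof. by case: z; case: w. Qed.
Lemma Re_N z : complex.Re (- z) = - complex.Re z.
Proof. by case: z. Qed.
Lemma Im_D z w : complex.Im (z + w) = complex.Im z + complex.Im w.
Proof. by case: z; case: w. Qed.
Lemma Re_M z w : complex.Re (z * w) = complex.Re z * complex.Re w - complex.Im z * complex.Im w.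
Proof. by case: z; case: w. Qed.
Lemma Im_M z w : complex.Im (z * w) = complex.Re z * complex.Im w + complex.Im z * complex.Re w.
Proof. by case: z => a b; case: w => c d. Qed.
Lemma Re_V z : complex.Re z^-1 = complex.Re z / (complex.Re z ^+ 2 + complex.Im z ^+ 2).
Proof. by case: z. Qed.
Lemma Im_V z : complex.Im z^-1 = - complex.Im z / (complex.Re z ^+ 2 + complex.Im z ^+ 2).
Proof. by case: z => a b /=; rewrite ?mulNr. Qed.

Lemma cabs_expn_le z (r : R) n : cabs z <= r -> cabs (z ^+ n) <= r ^+ n.
Proof.
by move=> zr; rewrite cabsX; apply: lerXn2r => //; rewrite nnegrE ?cabs_ge0//; exact: le_trans (cabs_ge0 z) zr.
Qed.

End ComplexAbs.

(** * Averages of complex-valued functions *)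

Section ComplexAverage.
Variable R : realType.
Notation C := R[i].
Implicit Types (f g : R * R -> C) (c : C).

Definition cmeasurable f : Prop :=
  measurable_fun setT (fun z => complex.Re (f z)) /\ measurable_fun setT (fun z => complex.Im (f z)).

Definition cbounded_measurable f : Prop :=
  cmeasurable f /\ exists M : R, forall z, cabs (f z) <= M.

Definition cavg f : C :=
  (avg (fun z => complex.Re (f z)))%:C%C + 'i%C * (avg (fun z => complex.Im (f z)))%:C%C.

Lemma cmeasurable_cst c : cmeasurable (fun=> c).
Proof. by []. Qed.

Lemma cmeasurableD f g : cmeasurable f -> cmeasurable g -> cmeasurable (fun z => f z + g z).
Proof.
move=> [mf nf] [mg ng]; split.
  by under eq_fun do rewrite Re_D; exact: measurable_funD.
by under eq_fun do rewrite Im_D; exact: measurable_funD.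
Qed.

Lemma cmeasurableM f g : cmeasurable f -> cmeasurable g -> cmeasurable (fun z => f z * g z).
Proof.
move=> [mf nf] [mg ng]; split.
  by under eq_fun do rewrite Re_M; apply: measurable_funB; exact: measurable_funM.
by under eq_fun do rewrite Im_M; apply: measurable_funD; exact: measurable_funM.
Qed.

Lemma cmeasurableV f : cmeasurable f -> cmeasurable (fun z => (f z)^-1).
Proof.
move=> [mf nf].
have ms : measurable_fun setT (fun z => (complex.Re (f z) ^+ 2 + complex.Im (f z) ^+ 2)^-1).
  (* The reciprocal is viewed as the real power with exponent - 1, which is measurable; both take
     the value 0 at 0. *)
  rewrite (_ : (fun z => _) = (@powR R ^~ (-1)) \o
      fun z => complex.Re (f z) ^+ 2 + complex.Im (f z) ^+ 2); last first.
    by apply/funext => z /=; rewrite powR_inv1// addr_ge0// sqr_ge0.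
  apply: measurableT_comp; first exact: measurable_powR.
  by apply: measurable_funD; exact: measurable_funX.
split; first by under eq_fun do rewrite Re_V; exact: measurable_funM.
by under eq_fun do rewrite Im_V; apply: measurable_funM => //; exact: measurable_funN.
Qed.

Lemma measurable_cabs f : cmeasurable f -> measurable_fun setT (fun z => cabs (f z)).
Proof.
move=> [mf nf].
rewrite (_ : (fun z => _) = fun z => Num.sqrt (complex.Re (f z) ^+ 2 + complex.Im (f z) ^+ 2)); last first.
  by apply/funext => z; rewrite /cabs normc_def.
have ms : measurable_fun setT (fun z => complex.Re (f z) ^+ 2 + complex.Im (f z) ^+ 2).
  by apply: measurable_funD; exact: measurable_funX.
apply: (measurableT_comp _ ms); apply: continuous_measurable_fun; exact: sqrt_continuous.
Qed.

Lemma cbm_Re f : cbounded_measurable f -> bounded_measurable (fun z => complex.Re (f z)).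
Proof.
move=> [[mf _] [M Mf]]; split => //; exists M => z.
by apply: le_trans (Mf z); exact: le_Re_cabs.
Qed.

Lemma cbm_Im f : cbounded_measurable f -> bounded_measurable (fun z => complex.Im (f z)).
Proof.
move=> [[_ mf] [M Mf]]; split => //; exists M => z.
by apply: le_trans (Mf z); exact: le_Im_cabs.
Qed.

Lemma cbm_cst c : cbounded_measurable (fun=> c).
Proof. by split; [exact: cmeasurable_cst|exists (cabs c)]. Qed.

Lemma cbmD f g : cbounded_measurable f -> cbounded_measurable g ->
  cbounded_measurable (fun z => f z + g z).
Proof.
move=> [mf [M Mf]] [mg [N Ng]]; split; first exact: cmeasurableD.
by exists (M + N) => z; apply: le_trans (cabsD _ _) _; exact: lerD.
Qed.

Lemma cbmM f g : cbounded_measurable f -> cbounded_measurable g ->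
  cbounded_measurable (fun z => f z * g z).
Proof.
move=> [mf [M Mf]] [mg [N Ng]]; split; first exact: cmeasurableM.
by exists (M * N) => z; rewrite cabsM ler_pM ?cabs_ge0.
Qed.

Lemma cavgD f g : cbounded_measurable f -> cbounded_measurable g ->
  cavg (fun z => f z + g z) = cavg f + cavg g.
Proof.
move=> bf bg; rewrite /cavg.
under eq_fun do rewrite Re_D.
under [in X in _ + _ * X]eq_fun do rewrite Im_D.
rewrite !avgD; try by [exact: cbm_Re|exact: cbm_Im].
by rewrite !rmorphD/=; ring.
Qed.

Lemma cavgZ c f : cbounded_measurable f -> cavg (fun z => c * f z) = c * cavg f.
Proof.
move=> bf; rewrite /cavg.
have bRe := cbm_Re bf; have bIm := cbm_Im bf.
under eq_fun do rewrite Re_M -mulNr.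
under [in X in _ + _ * X]eq_fun do rewrite Im_M.
have bm := bmM (bm_cst _) _.
rewrite !avgD; try exact: bm.
rewrite !avgZ//; case: c => a b /=; apply/eqP; rewrite eq_complex/=; apply/andP; split; apply/eqP; ring.
Qed.

Lemma cavg_cst c : cavg (fun=> c) = c.
Proof.
by rewrite /cavg !avg_cst; case: c => a b; apply/eqP; rewrite eq_complex/=; apply/andP; split; apply/eqP; ring.
Qed.

Lemma Re_cavg f : complex.Re (cavg f) = avg (fun z => complex.Re (f z)).
Proof. by rewrite /cavg/=; ring. Qed.

(** The factor 2 comes from bounding the averages of the real and imaginary parts separately. *)
Lemma cavg_bound f (M : R) : cmeasurable f -> (forall z, cabs (f z) <= M) -> cabs (cavg f) <= 2 * M.
Proof.
move=> [mf nf] Mf; apply: le_trans (cabsD _ _) _; rewrite cabsM.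
have -> : cabs ('i%C : C) = 1 by rewrite /cabs normc_def/= expr0n/= add0r expr1n sqrtr1.
rewrite !cabsR mul1r mulr_natl mulr2n; apply: lerD; apply: avg_bound => // z.
  by apply: le_trans (Mf z); exact: le_Re_cabs.
by apply: le_trans (Mf z); exact: le_Im_cabs.
Qed.

Lemma cavg_real (h : R * R -> R) : cavg (fun z => (h z)%:C%C) = (avg h)%:C%C.
Proof. by rewrite /cavg/= avg_cst mulr0 addr0. Qed.

End ComplexAverage.

(** * Calculus of first-order expansions uniform over the torus *)

Section UniformDifferentiability.
Variable R : realType.
Notation C := R[i].
Notation Om := (R * R)%type.
Implicit Types (f g : C -> Om -> C) (p q : C) (w : Om).

(* f' p w is the derivative of f in p, with a remainder quadratic in q - p and uniform in the
   parameter w: such expansions survive averaging over w, and no limit theorem is needed. *)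
Definition udiff_on (r M : R) f f' : Prop :=
  [/\ forall p, cabs p < r -> cmeasurable (f p) /\ cmeasurable (f' p),
      forall p w, cabs p < r -> cabs (f p w) <= M /\ cabs (f' p w) <= M &
      forall p q w, cabs p < r -> cabs q < r ->
        cabs (f q w - f p w - (q - p) * f' p w) <= M * cabs (q - p) ^+ 2].

Definition udiff f f' : Prop := exists r M : R, 0 < r /\ udiff_on r M f f'.

Lemma udiff_onW r M r' M' f f' : r' <= r -> M <= M' ->
  udiff_on r M f f' -> udiff_on r' M' f f'.
Proof.
move=> rr MM [mf bf df]; split.
- by move=> p pr; apply: mf; exact: lt_le_trans pr rr.
- move=> p w pr; have [a b] := bf p w (lt_le_trans pr rr).
  by split; [exact: le_trans a MM|exact: le_trans b MM].
- move=> p q w pr qr; apply: le_trans (df p q w (lt_le_trans pr rr) (lt_le_trans qr rr)) _.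
  by rewrite ler_wpM2r// exprn_ge0// cabs_ge0.
Qed.

Lemma udiff_on_ge0 r M f f' : 0 < r -> udiff_on r M f f' -> 0 <= M.
Proof.
move=> r0 [_ bf _]; have [|a _] := bf 0 (0, 0); first by rewrite cabs0.
by apply: le_trans a; exact: cabs_ge0.
Qed.

(** A radius at most 1 gives |q - p| <= 2, so one factor |q - p| of a quadratic term can be absorbed
    into a constant. *)
Lemma udiff_common f f' g g' : udiff f f' -> udiff g g' ->
  exists r M : R, [/\ 0 < r, r <= 1, 0 <= M, udiff_on r M f f' & udiff_on r M g g'].
Proof.
move=> [r [M [r0 uf]]] [s [N [s0 ug]]].
have M0 := udiff_on_ge0 r0 uf; have N0 := udiff_on_ge0 s0 ug.
exists (Num.min 1 (Num.min r s)), (Num.max M N); split.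
- by rewrite !lt_min ltr01 r0 s0.
- by rewrite ge_min lexx.
- by rewrite le_max M0.
- by apply: udiff_onW uf; rewrite ?ge_min ?lexx ?le_max ?lexx ?orbT.
- by apply: udiff_onW ug; rewrite ?ge_min ?lexx ?le_max ?lexx ?orbT.
Qed.

Lemma cabs_dist2 r p q : r <= 1 -> cabs p < r -> cabs q < r -> cabs (q - p) <= 2.
Proof. by move=> r1 pr qr; apply: le_trans (cabsB _ _) _; lra. Qed.

(** 3 M = M + 2 M: the derivative contributes M, the quadratic remainder 2 M because |q - p| <=
    2. *)
Lemma udiff_lipschitz r M f f' p q w : r <= 1 -> 0 <= M -> udiff_on r M f f' ->
  cabs p < r -> cabs q < r -> cabs (f q w - f p w) <= 3 * M * cabs (q - p).
Proof.
move=> r1 M0 [_ bf df] pr qr.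
have d := df p q w pr qr; have [_ b] := bf p w pr.
have k2 := cabs_dist2 r1 pr qr; have k0 := cabs_ge0 (q - p).
rewrite -(subrK ((q - p) * f' p w) (f q w - f p w)).
apply: le_trans (cabsD _ _) _; rewrite cabsM.
have h1 : cabs (q - p) * cabs (f' p w) <= cabs (q - p) * M by exact: ler_wpM2l.
have h2 : M * cabs (q - p) ^+ 2 <= M * (2 * cabs (q - p)).
  by rewrite ler_wpM2l// expr2 ler_wpM2r.
lra.
Qed.

Lemma cabsM_le (a b : C) (A B : R) : cabs a <= A -> cabs b <= B -> cabs (a * b) <= A * B.
Proof. by move=> aA bB; rewrite cabsM ler_pM ?cabs_ge0. Qed.

Lemma cabsD_le (a b : C) (A B : R) : cabs a <= A -> cabs b <= B -> cabs (a + b) <= A + B.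
Proof. by move=> aA bB; apply: le_trans (cabsD _ _) _; exact: lerD. Qed.

Lemma udiff_fun (h : Om -> C) : cbounded_measurable h -> udiff (fun=> h) (fun _ _ => 0).
Proof.
move=> [mh [M Mh]]; exists 1, M; split => //; split.
- by move=> p _; split => //; exact: cmeasurable_cst.
- move=> p w _; split => //; rewrite cabs0; apply: le_trans (Mh w); exact: cabs_ge0.
- move=> p q w _ _; rewrite subrr mulr0 subr0 cabs0 mulr_ge0 ?exprn_ge0 ?cabs_ge0//.
  by apply: le_trans (Mh w); exact: cabs_ge0.
Qed.

Lemma udiff_cst (c : C) : udiff (fun _ _ => c) (fun _ _ => 0).
Proof. by apply: udiff_fun; exact: cbm_cst. Qed.

Lemma udiff_id : udiff (fun p _ => p) (fun _ _ => 1).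
Proof.
exists 1, 1; split => //; split.
- by move=> p _; split; exact: cmeasurable_cst.
- by move=> p w p1; split; [exact: ltW|rewrite cabs1].
- by move=> p q w _ _; rewrite mulr1 subrr cabs0 mul1r exprn_ge0 ?cabs_ge0.
Qed.

Lemma udiffD f f' g g' : udiff f f' -> udiff g g' ->
  udiff (fun p w => f p w + g p w) (fun p w => f' p w + g' p w).
Proof.
move=> uf ug; have [r [M [r0 r1 M0 [mf bf df] [mg bg dg]]]] := udiff_common uf ug.
exists r, (M + M); split => //; split.
- move=> p pr; have [a b] := mf p pr; have [c d] := mg p pr.
  by split; exact: cmeasurableD.
- move=> p w pr; have [a b] := bf p w pr; have [c d] := bg p w pr.
  by split; exact: cabsD_le.
- move=> p q w pr qr; rewrite [X in _ <= X]mulrDl.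
  rewrite (_ : _ - _ - _ = (f q w - f p w - (q - p) * f' p w) + (g q w - g p w - (q - p) * g' p w)).
    by apply: cabsD_le; [exact: df|exact: dg].
  by ring.
Qed.

Lemma udiffM f f' g g' : udiff f f' -> udiff g g' ->
  udiff (fun p w => f p w * g p w) (fun p w => f' p w * g p w + f p w * g' p w).
Proof.
move=> uf ug; have [r [M [r0 r1 M0 uf1 ug1]]] := udiff_common uf ug.
have [mf bf df] := uf1; have [mg bg dg] := ug1.
(* 5 = 1 + 1 + 3: the remainders of the two factors, and the cross term, where the increment of g is
   estimated by [udiff_lipschitz]. *)
exists r, (5 * (M * M)); split => //; split.
- move=> p pr; have [a b] := mf p pr; have [c d] := mg p pr.
  by split; [exact: cmeasurableM|apply: cmeasurableD; exact: cmeasurableM].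
- move=> p w pr; have [a b] := bf p w pr; have [c d] := bg p w pr.
  have MM : 0 <= M * M by exact: mulr_ge0.
  split; first by apply: le_trans (cabsM_le a c) _; lra.
  by apply: le_trans (cabsD_le (cabsM_le b c) (cabsM_le a d)) _; lra.
- move=> p q w pr qr; have [a b] := bf p w pr; have [c d] := bg q w qr.
  rewrite (_ : _ - _ - _ = (f q w - f p w - (q - p) * f' p w) * g q w
     + f p w * (g q w - g p w - (q - p) * g' p w)
     + (q - p) * f' p w * (g q w - g p w)); last by ring.
  have h1 := cabsM_le (df p q w pr qr) c.
  have h2 := cabsM_le a (dg p q w pr qr).
  have h3 := cabsM_le (cabsM_le (lexx (cabs (q - p))) b) (udiff_lipschitz w r1 M0 ug1 pr qr).
  apply: le_trans (cabsD_le (cabsD_le h1 h2) h3) _; rewrite le_eqVlt; apply/orP; left; apply/eqP; ring.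
Qed.

Lemma udiff_lower f f' (m : R) : udiff f f' -> 0 < m -> (forall w, m <= cabs (f 0 w)) ->
  exists r M : R, [/\ 0 < r, r <= 1, 0 <= M, udiff_on r M f f' &
     forall p w, cabs p < r -> m / 2 <= cabs (f p w)].
Proof.
move=> uf m0 fm; have [r [M [r0 r1 M0 uf1 _]]] := udiff_common uf uf.
(* Within this radius f moves by at most m / 2 from its value at 0; the added 1 keeps the
   denominator positive when M = 0. *)
pose s := Num.min r (m / 2 / (3 * M + 1)).
have M1 : 0 < 3 * M + 1 by lra.
have s0 : 0 < s by rewrite lt_min r0/= !divr_gt0.
have sr : s <= r by rewrite ge_min lexx.
exists s, M; split => //; first exact: le_trans sr r1.
  exact: udiff_onW uf1.
move=> p w ps; have L := udiff_lipschitz w r1 M0 uf1 (p := 0) (q := p).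
have {L} L : cabs (f p w - f 0 w) <= 3 * M * cabs p.
  by rewrite -{2}(subr0 p); apply: L; rewrite ?cabs0//; exact: lt_le_trans ps sr.
have h : (3 * M + 1) * cabs p <= m / 2.
  by rewrite mulrC -ler_pdivlMr//; apply: le_trans (ltW ps) _; rewrite ge_min lexx orbT.
have := cabs_lower (f 0 w) (f p w - f 0 w); rewrite (addrC (f 0 w)) subrK.
have := fm w; have := cabs_ge0 p; lra.
Qed.

Lemma udiffV f f' (m : R) : udiff f f' -> 0 < m -> (forall w, m <= cabs (f 0 w)) ->
  udiff (fun p w => (f p w)^-1) (fun p w => - f' p w / (f p w) ^+ 2).
Proof.
move=> uf m0 fm; have [r [M [r0 r1 M0 uf1 lf]]] := udiff_lower uf m0 fm.
have [mf bf df] := uf1.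
pose K := (m / 2)^-1; have K0 : 0 < K by rewrite invr_gt0 divr_gt0.
have fne p w : cabs p < r -> f p w != 0.
  by move=> pr; rewrite -cabs_gt0; apply: lt_le_trans (lf p w pr); rewrite divr_gt0.
have fK p w : cabs p < r -> cabs (f p w)^-1 <= K.
  move=> pr; rewrite cabsV /K lef_pV2 ?posrE ?divr_gt0//; first exact: lf.
  by rewrite cabs_gt0 fne.
(* K bounds 1/f. M K^2 bounds the derivative and also the first part of the remainder; 3 M^2 K^3
   bounds the second part, a product of two first-order increments. *)
exists r, (K + M * K ^+ 2 + 3 * M * M * K ^+ 3); split => //.
have p1 : 0 <= M * K ^+ 2 by rewrite mulr_ge0 ?exprn_ge0 ?(ltW K0).
have p2 : 0 <= 3 * M * M * K ^+ 3 by rewrite !mulr_ge0 ?exprn_ge0 ?(ltW K0).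
split.
- move=> p pr; have [a b] := mf p pr; split; first exact: cmeasurableV.
  under eq_fun do rewrite -mulN1r; apply: cmeasurableM.
    by apply: cmeasurableM => //; exact: cmeasurable_cst.
  under eq_fun do rewrite expr2; apply: cmeasurableV; exact: cmeasurableM.
- move=> p w pr; have [a b] := bf p w pr; split.
    by apply: le_trans (fK p w pr) _; lra.
  rewrite -exprVn; apply: (@le_trans _ _ (M * K ^+ 2)); last by lra.
  by rewrite !expr2; apply: cabsM_le; [rewrite cabsN|apply: cabsM_le; exact: fK].
- move=> p q w pr qr; have [a b] := bf p w pr.
  rewrite (_ : _ - _ - _ = - (f q w - f p w - (q - p) * f' p w) * ((f q w)^-1 * (f p w)^-1)
     + (q - p) * f' p w * (f q w - f p w) * ((f q w)^-1 * ((f p w)^-1 * (f p w)^-1))); last first.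
    by field; rewrite !fne.
  have e1 := df p q w pr qr; rewrite -cabsN in e1.
  have h1 := cabsM_le e1 (cabsM_le (fK q w qr) (fK p w pr)).
  have h2 := cabsM_le (cabsM_le (cabsM_le (lexx (cabs (q - p))) b) (udiff_lipschitz w r1 M0 uf1 pr qr))
     (cabsM_le (fK q w qr) (cabsM_le (fK p w pr) (fK p w pr))).
  apply: le_trans (cabsD_le h1 h2) _.
  have k2 : 0 <= K * cabs (q - p) ^+ 2 by rewrite mulr_ge0 ?exprn_ge0 ?cabs_ge0// ltW.
  rewrite -subr_ge0; set X := (X in 0 <= X).
  by rewrite (_ : X = K * cabs (q - p) ^+ 2) // /X; ring.
Qed.

Lemma udiff_cavg f f' : udiff f f' ->
  udiff (fun p _ => cavg (f p)) (fun p _ => cavg (f' p)).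
Proof.
move=> uf; have [r [M [r0 r1 M0 [mf bf df] _]]] := udiff_common uf uf.
exists r, (2 * M); split => //; split.
- by move=> p _; split; exact: cmeasurable_cst.
- move=> p w pr; have [a b] := mf p pr.
  by split; apply: cavg_bound => // w'; have [] := bf p w' pr.
- move=> p q w pr qr; have [a b] := mf p pr; have [c d] := mf q qr.
  have cb p1 : cabs p1 < r -> cbounded_measurable (f p1).
    by move=> h; split; [exact: (mf _ h).1|exists M => z; exact: (bf p1 z h).1].
  have cb' p1 : cabs p1 < r -> cbounded_measurable (f' p1).
    by move=> h; split; [exact: (mf _ h).2|exists M => z; exact: (bf p1 z h).2].
  have sc (k : C) := cbmM (cbm_cst k) _.
  rewrite (_ : _ - _ - _ = cavg (fun z => f q z + (-1) * f p z + (- (q - p)) * f' p z)).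
    rewrite -mulrA; apply: cavg_bound.
      by apply: cmeasurableD; [apply: cmeasurableD => //|]; apply: cmeasurableM => //; exact: cmeasurable_cst.
    by move=> z; rewrite mulN1r mulNr; exact: df.
  rewrite !cavgD ?cavgZ; first (by ring); try exact: cb; try exact: cb'.
  - by apply: sc; exact: cb.
  - by apply: cbmD; [exact: cb|apply: sc; exact: cb].
  - by apply: sc; exact: cb'.
Qed.

(** The calculus rules produce unsimplified derivatives. Agreement near 0 is enough to replace them
    by closed forms, on a disc where the denominators do not vanish. *)
Lemma udiff_ext f f' g g' : udiff f f' ->
  (exists2 r : R, 0 < r & forall p w, cabs p < r -> f p w = g p w /\ f' p w = g' p w) ->
  udiff g g'.
Proof.
move=> [r [M [r0 uf]]] [s s0 e]; exists (Num.min r s), M; split.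
  by rewrite lt_min r0.
have [mf bf df] : udiff_on (Num.min r s) M f f' by apply: udiff_onW uf; rewrite ?ge_min ?lexx.
have fe p : cabs p < Num.min r s -> f p = g p.
  by rewrite lt_min => /andP[_ h]; apply/funext => w; case: (e p w h).
have fe' p : cabs p < Num.min r s -> f' p = g' p.
  by rewrite lt_min => /andP[_ h]; apply/funext => w; case: (e p w h).
split.
- by move=> p h; rewrite -fe// -fe'//; exact: mf.
- by move=> p w h; rewrite -fe// -fe'//; exact: bf.
- by move=> p q w h k; rewrite -!fe// -fe'//; exact: df.
Qed.

Lemma le_inv_nat0 (x K : R) : (forall n, x <= K / n.+1%:R) -> x <= 0.
Proof.
move=> h; rewrite leNgt; apply/negP => x0.
have /= := h (Num.bound (K / x)).
have K0 : 0 <= K by have := h 0%N; rewrite divr1; apply: le_trans; exact: ltW.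
rewrite ler_pdivlMr// leNgt => /negP; apply.
rewrite mulrC -ltr_pdivrMr//; apply: lt_trans (archi_boundP _) _.
  by rewrite divr_ge0// ltW.
by rewrite ltr_nat.
Qed.

(** Cutting the segment from 0 to p into n + 1 equal steps, each step changes Phi by O(1/(n+1)^2),
    so the total change is O(1/(n+1)) for every n. *)
Lemma cst_of_quadratic (Phi : C -> R) (r M : R) :
  (forall p q, cabs p < r -> cabs q < r -> p != 0 -> `|Phi q - Phi p| <= M * cabs (q - p) ^+ 2) ->
  forall p, cabs p < r -> Phi p = Phi 0.
Proof.
move=> h p pr; have [->//|p0] := eqVneq p 0.
apply/eqP; rewrite -subr_eq0 -normr_le0; apply: (@le_inv_nat0 _ (M * cabs p ^+ 2)) => n.
pose x k : C := (k%:R / n.+1%:R)%:C%C * p.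
have xr k : (k <= n.+1)%N -> cabs (x k) < r.
  move=> kn; rewrite cabsM cabsR normrM normfV !normr_nat; apply: le_lt_trans pr.
  by rewrite ler_piMl ?cabs_ge0// ler_pdivrMr// mul1r ler_nat.
have step k : (k <= n)%N -> `|Phi (x k.+1) - Phi (x k)| <= M * cabs p ^+ 2 / n.+1%:R ^+ 2.
  move=> kn; rewrite distrC; apply: le_trans (h (x k.+1) (x k) _ _ _) _.
  - exact: xr.
  - by apply: xr; exact: leqW.
  - by rewrite mulf_neq0// -cabs_eq0 cabsR normr_eq0 mulf_neq0// invr_eq0.
  rewrite /x -mulrBl -rmorphB/= -mulrBl -natr1 opprD addNKr cabsM cabsR mulN1r normrN normfV normr_nat.
  by rewrite exprMn exprVn mulrCA mulrC.
have tot k : (k <= n.+1)%N -> `|Phi (x k) - Phi 0| <= k%:R * (M * cabs p ^+ 2 / n.+1%:R ^+ 2).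
  elim: k => [|k IH] kn; first by rewrite /x mul0r mul0r subrr normr0 mul0r.
  rewrite -(subrK (Phi (x k)) (Phi (x k.+1))) -addrA; apply: le_trans (ler_normD _ _) _.
  by rewrite -natr1 mulrDl mul1r [X in _ <= X]addrC; apply: lerD; [exact: step|apply: IH; exact: ltnW].
have := tot n.+1 (leqnn _); rewrite {1}/x divff// mul1r => /le_trans; apply.
by rewrite le_eqVlt; apply/orP; left; apply/eqP; field.
Qed.

Lemma ccst_of_quadratic (Phi : C -> C) (r M : R) :
  (forall p q, cabs p < r -> cabs q < r -> p != 0 -> cabs (Phi q - Phi p) <= M * cabs (q - p) ^+ 2) ->
  forall p, cabs p < r -> Phi p = Phi 0.
Proof.
move=> h p pr; apply/eqP; rewrite eq_complex; apply/andP; split; apply/eqP.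
  apply: (@cst_of_quadratic (fun p => complex.Re (Phi p)) r M) => // a b ar br a0.
  by apply: le_trans (h a b ar br a0); rewrite -Re_N -Re_D le_Re_cabs.
apply: (@cst_of_quadratic (fun p => complex.Im (Phi p)) r M) => // a b ar br a0.
apply: le_trans (h a b ar br a0); rewrite (_ : _ - _ = complex.Im (Phi b - Phi a)) ?le_Im_cabs//.
by case: (Phi b) (Phi a) => ? ? [].
Qed.

Lemma udiff0_cst f f' : udiff f f' ->
  (exists2 r : R, 0 < r & forall p w, cabs p < r -> p != 0 -> f' p w = 0) ->
  exists2 r : R, 0 < r & forall p w, cabs p < r -> f p w = f 0 w.
Proof.
move=> [r [M [r0 uf]]] [s s0 e]; exists (Num.min r s); first by rewrite lt_min r0.
have [_ _ df] : udiff_on (Num.min r s) M f f' by apply: udiff_onW uf; rewrite ?ge_min ?lexx.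
move=> p w pr; apply: (@ccst_of_quadratic (fun p => f p w) (Num.min r s) M) => // a b ar br a0.
have := df a b w ar br; rewrite e ?mulr0 ?subr0//.
by move: ar; rewrite lt_min => /andP[].
Qed.

End UniformDifferentiability.

(** * First-order expansion of the average of log|f| *)

Section LogAverage.
Variable R : realType.
Notation C := R[i].
Notation Om := (R * R)%type.
Implicit Types (f g : C -> Om -> C) (p q z : C) (w : Om).

(** log|1 + z| = log(1 + y) / 2 with y = 2 Re z + |z|^2, and y - 4 y^2 <= log(1 + y) <= y for y >= -
    3/4. Since |y| <= (5/2) |z|, half of 4 y^2 is at most (25/2) |z|^2, and 13 suffices. *)
Lemma ln_cabs_1D z : cabs z <= 2^-1 -> `|ln (cabs (1 + z)) - complex.Re z| <= 13 * cabs z ^+ 2.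
Proof.
move=> z2; have z0 := cabs_ge0 z.
have c2 : 2^-1 <= cabs (1 + z) by have := cabs_lower 1 z; rewrite cabs1; lra.
have c0 : 0 < cabs (1 + z) by lra.
pose y := 2 * complex.Re z + cabs z ^+ 2.
have yE : cabs (1 + z) ^+ 2 = 1 + y.
  by rewrite /y !cabs_sqr; case: (z) => a b /=; ring.
have y4 : 4^-1 <= 1 + y.
  rewrite -yE (_ : 4^-1 = 2^-1 ^+ 2 :> R); last by field.
  by rewrite ler_pXn2r ?nnegrE ?cabs_ge0//; lra.
have lnE : ln (cabs (1 + z)) = ln (1 + y) / 2.
  by rewrite -yE lnXn// mulr2n; field.
have Rz : `|complex.Re z| <= cabs z := le_Re_cabs z.
have ya : `|y| <= 5 / 2 * cabs z.
  rewrite /y; apply: le_trans (ler_normD _ _) _; rewrite normrM normrX.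
  rewrite (ger0_norm (cabs_ge0 z)) (ger0_norm (_ : 0 <= 2))//.
  have : cabs z ^+ 2 <= cabs z / 2 by rewrite expr2 ler_wpM2l//; lra.
  lra.
have y2 : y ^+ 2 <= 25 / 4 * cabs z ^+ 2.
  rewrite -(real_normK (num_real y)) (_ : 25 / 4 * _ = (5 / 2 * cabs z) ^+ 2); last by field.
  by rewrite ler_pXn2r ?nnegrE ?mulr_ge0//; lra.
have ub : ln (1 + y) <= y by apply: le_ln1Dx; lra.
(* The lower bound is the upper bound for the logarithm applied to 1 / (1 + y). *)
have lb : y - 4 * y ^+ 2 <= ln (1 + y).
  have y1 : 0 < 1 + y by lra.
  have h : ln (1 + y)^-1 <= (1 + y)^-1 - 1.
    rewrite -[X in ln X](subrK 1) addrC; apply: le_ln1Dx.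
    have v0 : 0 < (1 + y)^-1 by rewrite invr_gt0.
    lra.
  rewrite lnV ?posrE// in h.
  have : (1 + y)^-1 - 1 <= - y + 4 * y ^+ 2.
    rewrite -subr_ge0 (_ : _ - _ = y ^+ 2 * (4 * (1 + y) - 1) / (1 + y)); last first.
      by field; rewrite gt_eqF.
    by apply: divr_ge0; [apply: mulr_ge0; [exact: sqr_ge0|lra]|lra].
  lra.
rewrite lnE ler_norml; apply/andP; split; rewrite /y in ub lb y2 *; lra.
Qed.

(** log|f| is not complex differentiable in p, so the result is a real expansion, with the real part
    of (q - p) E(f'/f) as linear term. Writing f q = f p (1 + z), the increment is log|1 + z|, which
    [ln_cabs_1D] handles. *)
Lemma udiff_ln f f' (m : R) : udiff f f' -> 0 < m -> (forall w, m <= cabs (f 0 w)) ->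
  exists r M : R, [/\ 0 < r, forall p w, cabs p < r -> f p w != 0,
     forall p, cabs p < r -> bounded_measurable (fun w => ln (cabs (f p w))),
     forall p, cabs p < r -> cbounded_measurable (fun w => f' p w / f p w) &
     forall p q, cabs p < r -> cabs q < r ->
      `|avg (fun w => ln (cabs (f q w))) - avg (fun w => ln (cabs (f p w)))
        - complex.Re ((q - p) * cavg (fun w => f' p w / f p w))| <= M * cabs (q - p) ^+ 2].
Proof.
move=> uf m0 fm; have [r [M [r0 r1 M0 uf1 lf]]] := udiff_lower uf m0 fm.
pose K := (m / 2)^-1; have K0 : 0 < K by rewrite invr_gt0 divr_gt0.
pose L := 3 * M * K; have L0 : 0 <= L by rewrite !mulr_ge0// ltW.
(* This radius gives |z| <= L |q - p| <= 2 L / (4 L + 1) <= 1/2, the range of [ln_cabs_1D]. *)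
pose s := Num.min r (4 * L + 1)^-1.
have s0 : 0 < s by rewrite lt_min r0 invr_gt0; lra.
have sr p : cabs p < s -> cabs p < r by rewrite lt_min => /andP[].
have [mf bf df] := uf1.
have fne p w : cabs p < r -> f p w != 0.
  by move=> pr; rewrite -cabs_gt0; apply: lt_le_trans (lf p w pr); rewrite divr_gt0.
have fK p w : cabs p < r -> cabs (f p w)^-1 <= K.
  move=> pr; rewrite cabsV /K lef_pV2 ?posrE ?divr_gt0//; first exact: lf.
  by rewrite cabs_gt0 fne.
have bln p : cabs p < r -> bounded_measurable (fun w => ln (cabs (f p w))).
  move=> pr; split.
    by apply: measurableT_comp; [exact: measurable_ln|apply: measurable_cabs; exact: (mf p pr).1].
  exists (`|ln (m / 2)| + `|ln (Num.max M 1)|) => w.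
  have c0 : 0 < cabs (f p w) by rewrite cabs_gt0 fne.
  have m1 : 0 < Num.max M 1 by rewrite lt_max ltr01 orbT.
  have lb : ln (m / 2) <= ln (cabs (f p w)).
    by rewrite ler_ln ?posrE ?divr_gt0//; exact: lf.
  have ub : ln (cabs (f p w)) <= ln (Num.max M 1).
    by rewrite ler_ln ?posrE// le_max (bf p w pr).1.
  have := ler_norm (ln (Num.max M 1)); have := ler_norm (- ln (m / 2)); rewrite normrN.
  have := normr_ge0 (ln (Num.max M 1)); have := normr_ge0 (ln (m / 2)).
  by rewrite ler_norml => *; apply/andP; split; lra.
have cb p : cabs p < r -> cbounded_measurable (fun w => f' p w / f p w).
  move=> pr; have [a b] := mf p pr; split.
    by apply: cmeasurableM => //; exact: cmeasurableV.
  by exists (M * K) => w; apply: cabsM_le; [exact: (bf p w pr).2|exact: fK].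
exists s, (13 * L ^+ 2 + M * K); split => //.
- by move=> p w /sr; exact: fne.
- by move=> p /sr; exact: bln.
- by move=> p /sr; exact: cb.
move=> p q ps qs; have pr := sr _ ps; have qr := sr _ qs.
have qp : cabs (q - p) <= 2 * (4 * L + 1)^-1.
  apply: le_trans (cabsB _ _) _; move: ps qs; rewrite !lt_min => /andP[_ a] /andP[_ b]; lra.
pose h w := complex.Re ((q - p) * (f' p w / f p w)).
have bh : bounded_measurable h.
  by apply: cbm_Re; apply: cbmM; [exact: cbm_cst|exact: cb].
rewrite -cavgZ ?Re_cavg -/h; last exact: cb.
rewrite (_ : _ - _ - _ = avg (fun w => ln (cabs (f q w)) + (-1) * ln (cabs (f p w)) + (-1) * h w)); last first.
  have bm1 := bmM (bm_cst (-1)) _.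
  rewrite !avgD ?avgZ; first (by ring); try exact: bln; try exact: bh.
  - by apply: bm1; exact: bln.
  - by apply: bmD; [exact: bln|apply: bm1; exact: bln].
  - by apply: bm1; exact: bh.
apply: avg_bound.
  have mln p1 : cabs p1 < r -> measurable_fun setT (fun w => ln (cabs (f p1 w))).
    by move=> h1; have [] := bln p1 h1.
  apply: measurable_funD; first apply: measurable_funD.
  - exact: mln.
  - by apply: measurable_funM => //; exact: mln.
  - by apply: measurable_funM => //; have [] := bh.
move=> w; pose z := (f q w - f p w) / f p w.
have zL : cabs z <= L * cabs (q - p).
  rewrite /L (_ : _ * _ * _ = 3 * M * cabs (q - p) * K); last by ring.
  by apply: cabsM_le; [exact: (udiff_lipschitz w r1 M0 uf1)|exact: fK].
have z2 : cabs z <= 2^-1.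
  apply: le_trans zL _; apply: le_trans (ler_wpM2l L0 qp) _.
  rewrite mulrA ler_pdivrMr; lra.
have fq : cabs (f q w) = cabs (f p w) * cabs (1 + z).
  by rewrite -cabsM /z mulrDr mulr1 mulrCA divff ?mulr1 ?fne// addrC subrK.
have c1 : 0 < cabs (1 + z) by have := cabs_lower 1 z; rewrite cabs1; lra.
rewrite fq lnM ?posrE //; last by rewrite cabs_gt0 fne.
rewrite (_ : _ + _ = (ln (cabs (1 + z)) - complex.Re z) + complex.Re (z - (q - p) * (f' p w / f p w))); last first.
  by rewrite Re_D Re_N -/(h w); ring.
apply: le_trans (ler_normD _ _) _; rewrite [X in _ <= X]mulrDl; apply: lerD.
  apply: le_trans (ln_cabs_1D z2) _; rewrite -mulrA ler_wpM2l// -exprMn.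
  by apply: lerXn2r zL; rewrite nnegrE ?cabs_ge0 //; exact: mulr_ge0 L0 (cabs_ge0 _).
apply: le_trans (le_Re_cabs _) _.
rewrite (_ : _ - _ = (f q w - f p w - (q - p) * f' p w) * (f p w)^-1); last first.
  by rewrite /z; field; exact: fne.
by rewrite mulrAC; apply: cabsM_le; [exact: df|exact: fK].
Qed.

End LogAverage.

(** * Moments of the cosine over a period *)

Section Moments.
Variable R : realType.
Notation leb := (@lebesgue_measure R).
Notation I01 := (`[0%R, 1%R]%classic : set R).

Definition ct (t : R) : R := cos (2 * pi * t).

Lemma ct_measurable : measurable_fun setT ct.
Proof.
apply: measurableT_comp; first by apply: continuous_measurable_fun; exact: continuous_cos.
exact: measurable_funM.
Qed.

Lemma ct_le1 t : `|ct t| <= 1.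
Proof. exact: cos_max. Qed.

Definition cosmom n : R := \int[leb]_(t in I01) ct t ^+ n.

Lemma cosmom0 : cosmom 0 = 1.
Proof.
rewrite /cosmom; under eq_Rintegral do rewrite expr0.
by rewrite Rintegral_cst//= [X in fine X](@leb01 R) mulr1.
Qed.

Lemma integrable01 (h : R -> R) (K : R) : measurable_fun setT h -> (forall x, `|h x| <= K) ->
  leb.-integrable I01 (EFin \o h).
Proof.
move=> mh Kh; apply: measurable_bounded_integrable => //.
- by rewrite [X in (X < _)%E](@leb01 R) ltry.
- exact: measurable_funTS.
- exists K; split; first exact: num_real.
  by move=> x x1 z _; apply: le_trans (ltW x1).
Qed.

Lemma ctX_measurable n : measurable_fun setT (fun t => ct t ^+ n).
Proof. by apply: measurable_funX; exact: ct_measurable. Qed.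

Lemma ctX_le1 n t : `|ct t ^+ n| <= 1.
Proof. by rewrite normrX exprn_ile1// ct_le1. Qed.

Lemma ctX_integrable n (k : R) : leb.-integrable I01 (EFin \o (fun t => k * ct t ^+ n)).
Proof.
apply: (@integrable01 _ `|k|); first by apply: measurable_funM => //; exact: ctX_measurable.
by move=> x; rewrite normrM ler_piMr// ctX_le1.
Qed.

Definition st (t : R) : R := sin (2 * pi * t).

Lemma lin_derive (x : R) : is_derive x 1 (fun t : R => 2 * pi * t) (2 * pi).
Proof.
have h := is_deriveZ (2 * pi : R) (is_derive_id x (1 : R)).
by apply: (is_derive_eq h); rewrite /GRing.scale/= mulr1.
Qed.

Lemma ct_derive (x : R) : is_derive x 1 ct (- (2 * pi) * st x).
Proof.
have h := is_derive1_comp (is_derive_cos (2 * pi * x)) (lin_derive x).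
by apply: (is_derive_eq h); rewrite /st; ring.
Qed.

Lemma st_derive (x : R) : is_derive x 1 st (2 * pi * ct x).
Proof.
have h := is_derive1_comp (is_derive_sin (2 * pi * x)) (lin_derive x).
by apply: (is_derive_eq h); rewrite /ct; ring.
Qed.

Lemma ctX_derive n (x : R) : is_derive x 1 (fun t => ct t ^+ n.+1) (- (2 * pi) * n.+1%:R * ct x ^+ n * st x).
Proof.
elim: n => [|n IH].
  by have h := ct_derive x; apply: (is_derive_eq h); rewrite expr0; ring.
have h := is_deriveM (ct_derive x) IH.
rewrite (_ : (fun t => _) = ct * (fun t => ct t ^+ n.+1)); last by apply/funext => t; rewrite exprS.
apply: (is_derive_eq h); rewrite /GRing.scale/= -[n.+2%:R]natr1 !exprS; ring.
Qed.

(** It vanishes at 0 and 1, and its derivative involves only the powers n and n + 2 of the cosine: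
    integration gives the Wallis recurrence [cosmomS]. *)
Definition cosprim n (t : R) : R := st t * ct t ^+ n.+1.

Lemma cosprim_derive n (x : R) : is_derive x 1 (cosprim n)
  (2 * pi * (n.+2%:R * ct x ^+ n.+2 - n.+1%:R * ct x ^+ n)).
Proof.
have h := is_deriveM (st_derive x) (ctX_derive n x).
apply: (is_derive_eq h); rewrite /GRing.scale/=.
have e : st x ^+ 2 = 1 - ct x ^+ 2 by exact: sin2cos2.
rewrite -[n.+2%:R]natr1 !exprS -!mulrA.
rewrite (_ : st x * _ = - (2 * pi) * n.+1%:R * ct x ^+ n * (st x ^+ 2)); last by rewrite expr2; ring.
by rewrite e; ring.
Qed.

Lemma cosmomS n : cosmom n.+2 * n.+2%:R = cosmom n * n.+1%:R.
Proof.
have d x := cosprim_derive n x.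
have cd x : {for x, continuous (cosprim n)}.
  apply: differentiable_continuous; apply/derivable1_diffP; exact: (d x).(ex_derive).
have cc x : {for x, continuous ct}.
  apply: differentiable_continuous; apply/derivable1_diffP; exact: (ct_derive x).(ex_derive).
have pin0 : 2 * pi != 0 :> R by rewrite mulf_neq0// gt_eqF// pi_gt0.
pose f := fun x : R => 2 * pi * (n.+2%:R * ct x ^+ n.+2 - n.+1%:R * ct x ^+ n).
have ccX m x : {for x, continuous (fun x => ct x ^+ m)}.
  exact: (continuous_comp (cc x) (@exprn_continuous R m (ct x))).
have cf x : {for x, continuous f}.
  apply: cvgM; first exact: cvg_cst.
  apply: cvgB; apply: cvgM; try exact: cvg_cst; exact: ccX.
have := @continuous_FTC2 R f (cosprim n) 0 1 ltr01.
have s0 : cosprim n 1 = 0.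
  by rewrite /cosprim /st mulr1 mulr_natl sin2pi mul0r.
have s1 : cosprim n 0 = 0.
  by rewrite /cosprim /st mulr0 sin0 mul0r.
rewrite s0 s1 subee// => H.
have {H} : (\int[leb]_(x in I01) (f x)%:E = 0)%E.
  apply: H.
  - by apply: continuous_subspaceT => x; exact: cf.
  - split; first by move=> x _; exact: (d x).(ex_derive).
    + by apply: cvg_at_right_filter; exact: cd.
    + by apply: cvg_at_left_filter; exact: cd.
  - by move=> x _; rewrite derive1E (d x).(derive_val).
move=> H; have : \int[leb]_(x in I01) f x = 0 by rewrite /Rintegral H.
have i1 m : leb.-integrable I01 (EFin \o (fun t => ct t ^+ m)).
  by apply: (@integrable01 _ 1); [exact: ctX_measurable|move=> x; exact: ctX_le1].
rewrite /f RintegralZl//; last first.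
  apply: (@integrable01 _ (n.+2%:R + n.+1%:R)).
    by apply: measurable_funB; apply: measurable_funM => //; exact: ctX_measurable.
  move=> x; apply: le_trans (ler_normB _ _) _.
  by rewrite (normrM n.+2%:R) (normrM n.+1%:R) !normr_nat; apply: lerD; rewrite ler_piMr// ctX_le1.
move=> /eqP; rewrite mulf_eq0 (negbTE pin0)/= RintegralB//=; try exact: ctX_integrable.
rewrite !RintegralZl//; try exact: i1.
by rewrite subr_eq0 => /eqP e; rewrite mulrC e mulrC.
Qed.

Lemma cosmom1 : cosmom 1 = 0.
Proof.
have cc x : {for x, continuous ct}.
  apply: differentiable_continuous; apply/derivable1_diffP; exact: (ct_derive x).(ex_derive).
have pin0 : 2 * pi != 0 :> R by rewrite mulf_neq0// gt_eqF// pi_gt0.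
have cs x : {for x, continuous st}.
  apply: differentiable_continuous; apply/derivable1_diffP; exact: (st_derive x).(ex_derive).
have := @continuous_FTC2 R (fun x => 2 * pi * ct x) st 0 1 ltr01.
have s0 : st 1 = 0 by rewrite /st mulr1 mulr_natl sin2pi.
have s1 : st 0 = 0 by rewrite /st mulr0 sin0.
rewrite s0 s1 subee// => H.
have {H} H : (\int[leb]_(x in I01) (2 * pi * ct x)%:E = 0)%E.
  apply: H.
  - by apply: continuous_subspaceT => x; apply: cvgM; [exact: cvg_cst|exact: cc].
  - split; first by move=> x _; exact: (st_derive x).(ex_derive).
    + by apply: cvg_at_right_filter; exact: cs.
    + by apply: cvg_at_left_filter; exact: cs.
  - by move=> x _; rewrite derive1E (st_derive x).(derive_val).
have : \int[leb]_(x in I01) (2 * pi * ct x) = 0 by rewrite /Rintegral H.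
rewrite RintegralZl//; last by apply: (@integrable01 _ 1); [exact: ct_measurable|move=> x; exact: ct_le1].
by move=> /eqP; rewrite mulf_eq0 (negbTE pin0)/= => /eqP.
Qed.

Lemma cosmom_odd n : odd n -> cosmom n = 0.
Proof.
elim/ltn_ind: n => -[|[|n]] IH //= on; first exact: cosmom1.
have := cosmomS n; rewrite (IH n) ?mul0r//; last by rewrite negbK in on.
by move/eqP; rewrite mulf_eq0 pnatr_eq0 orbF => /eqP.
Qed.

Lemma cosmom_even n : cosmom n.*2 = ('C(n.*2, n))%:R / 4 ^+ n.
Proof.
elim: n => [|n IH]; first by rewrite cosmom0 bin0 expr0 divr1.
have e := cosmomS n.*2; rewrite IH in e.
have b : ('C(n.+1.*2, n.+1) * n.+1 = 2 * n.*2.+1 * 'C(n.*2, n))%N.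
  have h1 := mul_bin_diag n.*2.+2 n; have h3 := mul_bin_down n.*2.+1 n.
  rewrite /= in h1 h3 *.
  have nn : (n.*2.+1 - n = n.+1)%N by rewrite -addnn; lia.
  rewrite nn in h3; rewrite doubleS mulnC -h1.
  have n2 : n.*2.+2 = (2 * n.+1)%N by rewrite mul2n doubleS.
  by rewrite [X in (X * _)%N]n2 -[LHS]mulnA -h3 mulnA.
have n2 : n.*2.+2%:R != 0 :> R by rewrite pnatr_eq0.
apply: (mulIf n2); rewrite doubleS e.
have n1 : n.+1%:R != 0 :> R by rewrite pnatr_eq0.
apply: (mulIf n1); rewrite -doubleS.
have bR : ('C(n.+1.*2, n.+1))%:R * n.+1%:R = 2 * n.*2.+1%:R * ('C(n.*2, n))%:R :> R.
  by rewrite -!natrM b.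
rewrite exprS; have -> : n.+1.*2%:R = 2 * n.+1%:R :> R by rewrite -natrM mul2n.
rewrite [RHS](_ : _ = ('C(n.+1.*2, n.+1))%:R * n.+1%:R * (2 * n.+1%:R) / (4 * 4 ^+ n)); last first.
  by field; rewrite expf_neq0.
by rewrite bR; field; rewrite expf_neq0.
Qed.

End Moments.

(** * Equality of the moments of X and of Z^2 *)

Section TorusVariables.
Variable R : realType.
Notation C := R[i].
Notation Om := (R * R)%type.
Implicit Types (w : Om) (t v : C).

(* On the torus, (x + 1/x)^2 (y + 1/y)^2 / 16 and (x + 1/x + y + 1/y) / 4. *)
Definition Xr w : R := ct w.1 ^+ 2 * ct w.2 ^+ 2.
Definition Zr w : R := (ct w.1 + ct w.2) / 2.
Definition Xc w : C := (Xr w)%:C%C.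
Definition Zc w : C := (Zr w)%:C%C.

Lemma ct2_itv (x : R) : 0 <= ct x ^+ 2 <= 1.
Proof. by rewrite sqr_ge0/= -real_normK ?num_real// exprn_ile1// ct_le1. Qed.

Lemma Xr_ge0 w : 0 <= Xr w.
Proof. by rewrite mulr_ge0// sqr_ge0. Qed.

Lemma Xr_le1 w : Xr w <= 1.
Proof.
have /andP[a b] := ct2_itv w.1; have /andP[c d] := ct2_itv w.2.
by rewrite /Xr -(mul1r 1) ler_pM.
Qed.

Lemma cabs_Xc w : cabs (Xc w) <= 1.
Proof. by rewrite cabsR ger0_norm ?Xr_ge0// Xr_le1. Qed.

Lemma cabs_Zc w : cabs (Zc w) <= 1.
Proof.
rewrite cabsR /Zr normrM normfV (ger0_norm (_ : 0 <= 2))// ler_pdivrMr// mul1r.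
by apply: le_trans (ler_normD _ _) _; rewrite (_ : 2 = 1 + 1) // lerD// ct_le1.
Qed.

Lemma measurable_ct1 : measurable_fun setT (fun w : Om => ct w.1).
Proof. by apply: measurableT_comp => //; exact: ct_measurable. Qed.

Lemma measurable_ct2 : measurable_fun setT (fun w : Om => ct w.2).
Proof. by apply: measurableT_comp => //; exact: ct_measurable. Qed.

Lemma cmeasurable_real (h : Om -> R) : measurable_fun setT h -> cmeasurable (fun w => (h w)%:C%C).
Proof. by move=> mh; split. Qed.

Lemma cbm_Xc : cbounded_measurable Xc.
Proof.
split; last by exists 1; exact: cabs_Xc.
apply: cmeasurable_real; apply: measurable_funM; apply: measurable_funX.
  exact: measurable_ct1.
exact: measurable_ct2.
Qed.

Lemma cbm_Zc : cbounded_measurable Zc.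
Proof.
split; last by exists 1; exact: cabs_Zc.
apply: cmeasurable_real; apply: measurable_funM => //.
by apply: measurable_funD; [exact: measurable_ct1|exact: measurable_ct2].
Qed.

Lemma cbmX (f : Om -> C) n : cbounded_measurable f -> cbounded_measurable (fun w => f w ^+ n).
Proof.
move=> bf; elim: n => [|n IH]; first by under eq_fun do rewrite expr0; exact: cbm_cst.
by under eq_fun do rewrite exprS; exact: cbmM.
Qed.

Lemma cbmV (f : Om -> C) (m : R) : cbounded_measurable f -> 0 < m -> (forall w, m <= cabs (f w)) ->
  cbounded_measurable (fun w => (f w)^-1).
Proof.
move=> [mf _] m0 fm; split; first exact: cmeasurableV.
exists m^-1 => w; rewrite cabsV lef_pV2 ?posrE//; exact: lt_le_trans (fm w).
Qed.

Lemma cbmN (f : Om -> C) : cbounded_measurable f -> cbounded_measurable (fun w => - f w).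
Proof. by move=> bf; under eq_fun do rewrite -mulN1r; apply: cbmM => //; exact: cbm_cst. Qed.

Lemma cabs_1B v (x : C) : cabs v <= 2^-1 -> cabs x <= 1 -> 2^-1 <= cabs (1 + v * x).
Proof.
move=> v2 x1; have := cabs_lower 1 (v * x); rewrite cabs1.
have := cabsM_le v2 x1; lra.
Qed.

Lemma cbm_geomX v : cabs v <= 2^-1 -> cbounded_measurable (fun w => (1 + v * Xc w)^-1).
Proof.
move=> v2; apply: (@cbmV _ 2^-1) => //; last by move=> w; apply: cabs_1B => //; exact: cabs_Xc.
apply: cbmD; first exact: cbm_cst.
by apply: cbmM; [exact: cbm_cst|exact: cbm_Xc].
Qed.

Lemma cbm_geomZ v : cabs v <= 2^-1 -> cbounded_measurable (fun w => (1 + v * Zc w)^-1).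
Proof.
move=> v2; apply: (@cbmV _ 2^-1) => //; last by move=> w; apply: cabs_1B => //; exact: cabs_Zc.
apply: cbmD; first exact: cbm_cst.
by apply: cbmM; [exact: cbm_cst|exact: cbm_Zc].
Qed.

(** By [cosmom_even] this is (C(2n, n) / 4^n)^2 = ((1/2)_n / n!)^2, the n-th coefficient of 2F1(1/2,
    1/2; 1; t); [momS] is its hypergeometric recurrence. *)
Definition mom n : R := cosmom R n.*2 ^+ 2.

Lemma momS n : (n.+1%:R : R) ^+ 2 * mom n.+1 = (n%:R + 2^-1) ^+ 2 * mom n.
Proof.
have := cosmomS R n.*2; rewrite -doubleS.
have -> : n.*2.+2%:R = 2 * n.+1%:R :> R by rewrite -natrM mul2n.
have -> : n.*2.+1%:R = 2 * (n%:R + 2^-1) :> R by rewrite -natr1 -mul2n natrM; field.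
move=> e; rewrite /mom -!exprMn; congr (_ ^+ 2).
have n2 : 2 != 0 :> R by [].
by apply: (mulfI n2); rewrite mulrA mulrC e; ring.
Qed.

Lemma avg_ctM m n : avg (fun w : Om => ct w.1 ^+ m * ct w.2 ^+ n) = cosmom R m * cosmom R n.
Proof.
apply: (@avg_prod _ (fun x => ct x ^+ m) (fun x => ct x ^+ n)); try exact: ctX_measurable.
  by exists 1 => x; exact: ctX_le1.
by exists 1 => x; exact: ctX_le1.
Qed.

Lemma avg_XrX n : avg (fun w => Xr w ^+ n) = mom n.
Proof.
rewrite /mom expr2 -avg_ctM; congr avg; apply/funext => w.
by rewrite /Xr exprMn -!exprM mul2n.
Qed.

Lemma avg_sum (I : Type) (s : seq I) (f : I -> Om -> R) :
  (forall i, bounded_measurable (f i)) ->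
  bounded_measurable (fun w => \sum_(i <- s) f i w) /\
  avg (fun w => \sum_(i <- s) f i w) = \sum_(i <- s) avg (f i).
Proof.
move=> bf; elim: s => [|i s [IH1 IH2]].
  rewrite (_ : (fun w => _) = fun=> 0); last by apply/funext => w; rewrite big_nil.
  by split; [exact: bm_cst|rewrite avg_cst big_nil].
rewrite (_ : (fun w => _) = fun w => f i w + \sum_(j <- s) f j w); last first.
  by apply/funext => w; rewrite big_cons.
by split; [exact: bmD|rewrite avgD// IH2 big_cons].
Qed.

Lemma avg_ZrX m : avg (fun w => Zr w ^+ m) =
  2^-1 ^+ m * \sum_(i < m.+1) 'C(m, i)%:R * (cosmom R (m - i) * cosmom R i).
Proof.
pose f (i : 'I_m.+1) (w : Om) : R := 2^-1 ^+ m * 'C(m, i)%:R * (ct w.1 ^+ (m - i) * ct w.2 ^+ i).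
have bct k l : bounded_measurable (fun w : Om => ct w.1 ^+ k * ct w.2 ^+ l).
  split.
    by apply: measurable_funM; apply: measurable_funX; [exact: measurable_ct1|exact: measurable_ct2].
  by exists 1 => w; rewrite normrM -(mulr1 1) ler_pM// ctX_le1.
have bf i : bounded_measurable (f i) by apply: bmM => //; exact: bm_cst.
have [_ e] := avg_sum (index_enum _) bf.
transitivity (avg (fun w => \sum_i f i w)).
  congr avg; apply/funext => w; rewrite /Zr exprMn mulrC exprDn big_distrr/=.
  by apply: eq_bigr => i _; rewrite /f -mulr_natl; ring.
rewrite e big_distrr/=; apply: eq_bigr => i _.
by rewrite /f avgZ// avg_ctM; ring.
Qed.

Lemma avg_ZrX_odd m : odd m -> avg (fun w => Zr w ^+ m) = 0.
Proof.
move=> om; rewrite avg_ZrX big1 ?mulr0// => i _.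
have [oi|ei] := boolP (odd i); first by rewrite (cosmom_odd _ oi) !mulr0.
rewrite (@cosmom_odd _ (m - i)) ?mul0r ?mulr0// oddB ?om ?(negbTE ei)//.
by rewrite -ltnS.
Qed.

Lemma sum_even (V : nmodType) (f : nat -> V) n : (forall i, odd i -> f i = 0) ->
  \sum_(i < n.*2.+1) f i = \sum_(k < n.+1) f k.*2.
Proof.
move=> f0; elim: n => [|n IH]; first by rewrite !big_ord1.
by rewrite doubleS big_ord_recr big_ord_recr [RHS]big_ord_recr/= IH (f0 n.*2.+1) ?addr0//= odd_double.
Qed.

(** Both sides equal (2n)! / (k! (n - k)!)^2. The right side isolates the factor that depends on k
    in a form that Vandermonde's identity sums. *)
Lemma bin_square n k : (k <= n)%N ->
  ('C(n.*2, k.*2) * ('C((n - k).*2, n - k) * 'C(k.*2, k)) = 'C(n.*2, n) * ('C(n, k) * 'C(n, n - k)))%N.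
Proof.
move=> kn; have k2 : (k.*2 <= n.*2)%N by rewrite leq_double.
have h1 := bin_fact k2; have h2 := @bin_fact (n - k).*2 (n - k).
have h3 := @bin_fact k.*2 k; have h4 := @bin_fact n.*2 n; have h5 := bin_fact kn.
have dd m : (m.*2 - m = m)%N by rewrite -addnn addnK.
have ledd m : (m <= m.*2)%N by rewrite -addnn leq_addr.
move: (h2 (ledd _)) (h3 (ledd _)) (h4 (ledd _)); rewrite !dd => {}h2 {}h3 {}h4.
rewrite -doubleB in h1; rewrite bin_sub//.
have p1 : (0 < k`! * (n - k)`!)%N by rewrite muln_gt0 !fact_gt0.
have p2 : (0 < (k`! * (n - k)`!) * (k`! * (n - k)`!))%N by rewrite muln_gt0 p1.
apply/eqP; rewrite -(eqn_pmul2r p2); apply/eqP.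
transitivity (n.*2)`!.
  rewrite -h1 -h2 -h3; ring.
rewrite -h4 -h5; ring.
Qed.

(** The substitution x = a b, y = a / b explains the coincidence: it turns x + 1/x + y + 1/y into (a
    + 1/a)(b + 1/b). The proof compares moments, through Vandermonde's sum of C(n, k) C(n, n -
    k). *)
Lemma avg_ZrX_even n : avg (fun w => Zr w ^+ n.*2) = mom n.
Proof.
rewrite avg_ZrX.
pose f i : R := 'C(n.*2, i)%:R * (cosmom R (n.*2 - i) * cosmom R i).
rewrite (@sum_even _ f); last by move=> i oi; rewrite /f (cosmom_odd _ oi) !mulr0.
rewrite /mom cosmom_even.
have fE (k : 'I_n.+1) : f k.*2 = 4 ^- n * 'C(n.*2, n)%:R * ('C(n, k) * 'C(n, n - k))%:R.
  have kn : (k <= n)%N by rewrite -ltnS.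
  rewrite -[RHS]mulrA -natrM -bin_square// /f -doubleB !cosmom_even !natrM.
  have e4 : 4 ^+ n = 4 ^+ (n - k) * 4 ^+ k :> R by rewrite -exprD subnK.
  rewrite e4; field.
  by rewrite !expf_neq0.
rewrite (eq_bigr _ (fun k _ => fE k)) -big_distrr/= -natr_sum binomial.Vandermonde addnn.
have -> : (2^-1 : R) ^+ n.*2 = 4 ^- n.
  by rewrite -mul2n exprM exprVn (_ : 2 ^+ 2 = 4 :> R) ?exprVn// -natrX.
by rewrite exprMn exprVn; field; rewrite expf_neq0.
Qed.

Lemma cavg_Xc n : cavg (fun w => Xc w ^+ n) = (mom n)%:C%C.
Proof.
rewrite -avg_XrX -cavg_real; congr cavg; apply/funext => w.
by rewrite -rmorphXn.
Qed.

Lemma cavg_Zc_even n : cavg (fun w => Zc w ^+ n.*2) = (mom n)%:C%C.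
Proof.
rewrite -avg_ZrX_even -cavg_real; congr cavg; apply/funext => w.
by rewrite -rmorphXn.
Qed.

Lemma cavg_Zc_odd n : cavg (fun w => Zc w ^+ n.*2.+1) = 0.
Proof.
transitivity ((avg (fun w => Zr w ^+ n.*2.+1))%:C%C : C).
  by rewrite -cavg_real; congr cavg; apply/funext => w; rewrite -rmorphXn.
by rewrite avg_ZrX_odd//= odd_double.
Qed.

End TorusVariables.

Ltac cbm := lazymatch goal with
  | |- cbounded_measurable (fun w => (@?f w + @?g w)%R) => apply (@cbmD _ f g); cbm
  | |- cbounded_measurable (fun w => (@?f w * @?g w)%R) => apply (@cbmM _ f g); cbm
  | |- cbounded_measurable (fun w => (- (@?f w))%R) => apply (@cbmN _ f); cbm
  | |- cbounded_measurable (fun w => (@?f w ^+ ?n)%R) => apply (@cbmX _ f n); cbm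
  | |- cbounded_measurable (fun w => Xc w) => exact (@cbm_Xc _)
  | |- cbounded_measurable (fun w => Zc w) => exact (@cbm_Zc _)
  | |- _ => first [assumption | apply cbm_cst]
  end.

Ltac cabs_le := first [assumption | lazymatch goal with
  | |- is_true (cabs (?a + - ?b) <= _)%R => apply cabsD_le; [cabs_le|rewrite cabsN; cabs_le]
  | |- is_true (cabs (?a + ?b) <= _)%R => apply cabsD_le; cabs_le
  | |- is_true (cabs (?a * ?b) <= _)%R => apply cabsM_le; cabs_le
  | |- is_true (cabs (?a ^+ ?b) <= _)%R => apply cabs_expn_le; cabs_le
  end].

(** * Hypergeometric equation and the link between Z and X, by remainders of geometric series *)

Section Hypergeometric.
Variable R : realType.
Notation C := R[i].
Notation Om := (R * R)%type.
Notation X := (@Xc R).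
Notation Z := (@Zc R).
Implicit Types (w : Om) (t v : C).

(** This takes the place of exchanging a series with the average: rho n is the remainder after n
    terms, the removed terms have average zero, and the remainder tends to 0 uniformly. *)
Lemma cavg_eq0_limit (rho : nat -> Om -> C) (K : R) :
  (forall n, cmeasurable (rho n)) -> (forall n, cavg (rho n) = cavg (rho n.+1)) ->
  (forall n w, cabs (rho n w) <= K / n.+1%:R) -> cavg (rho 0%N) = 0.
Proof.
move=> mr er br; apply/eqP; rewrite -cabs_eq0 eq_le cabs_ge0 andbT.
apply: (@le_inv_nat0 _ _ (2 * K)) => n.
have -> : cavg (rho 0%N) = cavg (rho n) by elim: n => // n ->.
by rewrite -mulrA; apply: cavg_bound.
Qed.

(* 2F1 (1/2, 1/2; 1; t) and its first two derivatives, for small t. *)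
Definition hypF t : C := cavg (fun w => (1 - t * X w)^-1).
Definition hypF1 t : C := cavg (fun w => X w * (1 - t * X w)^-1 ^+ 2).
Definition hypF2 t : C := cavg (fun w => 2 * X w ^+ 2 * (1 - t * X w)^-1 ^+ 3).

Lemma cbm_geom t : cabs t <= 2^-1 -> cbounded_measurable (fun w => (1 - t * X w)^-1).
Proof.
move=> t2; under eq_fun do rewrite -mulNr; apply: cbm_geomX.
by rewrite cabsN.
Qed.

Lemma geomX_ge t w : cabs t <= 2^-1 -> 2^-1 <= cabs (1 - t * X w).
Proof. by move=> t2; rewrite -mulNr; apply: cabs_1B; [rewrite cabsN|exact: cabs_Xc]. Qed.

Lemma geomX_neq0 t w : cabs t <= 2^-1 -> 1 - t * X w != 0.
Proof. by move=> t2; rewrite -cabs_gt0; have := geomX_ge w t2; lra. Qed.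

Lemma geomX_inv_le t w : cabs t <= 2^-1 -> cabs (1 - t * X w)^-1 <= 2.
Proof.
move=> t2; rewrite cabsV -[leRHS]invrK lef_pV2 ?posrE//; first exact: geomX_ge.
by have := geomX_ge w t2; lra.
Qed.

Lemma geomZ_neq0 v w : cabs v <= 2^-1 -> 1 + v * Z w != 0.
Proof. by move=> t2; rewrite -cabs_gt0; have := cabs_1B t2 (cabs_Zc w); lra. Qed.

Lemma geomZ_inv_le v w : cabs v <= 2^-1 -> cabs (1 + v * Z w)^-1 <= 2.
Proof.
move=> t2; have h := cabs_1B t2 (cabs_Zc w).
by rewrite cabsV -[leRHS]invrK lef_pV2 ?posrE//; lra.
Qed.

(** The remainder in [hypF_ode] carries a factor quadratic in n. Against 8^-n <= (n + 1)^-3 it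
    becomes O(1/(n+1)); this is where the radius 1/8 comes from. *)
Lemma cubic_le_exp n : (n.+1%:R : R) ^+ 3 <= 8 ^+ n.
Proof.
have h : (n.+1%:R : R) <= 2 ^+ n by rewrite -natrX ler_nat; exact: ltn_expl.
rewrite (_ : 8 = 2 ^+ 3 :> R); last by rewrite -natrX.
by rewrite exprAC; apply: lerXn2r => //; rewrite nnegrE ?exprn_ge0.
Qed.

Lemma inv8_le n : (8^-1 : R) ^+ n <= (n.+1%:R ^+ 3)^-1.
Proof. by rewrite exprVn lef_pV2 ?posrE ?exprn_gt0// cubic_le_exp. Qed.

(* With theta = X d/dX and g = 1/(1 - tX), the equation says that theta^2 (X g) - (theta + 1/2)^2 g
   has average zero; rho n is what remains of this function once the first n terms of the
   geometric series g, which contribute nothing because of the recurrence momS, are removed. *)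
Lemma hypF_ode t : cabs t <= 8^-1 ->
  t * (1 - t) * hypF2 t + (1 - 2 * t) * hypF1 t - hypF t / 4 = 0.
Proof.
move=> t8; have t2 : cabs t <= 2^-1 by lra.
pose rho (n : nat) w : C := t ^+ n * (X w ^+ n * (
  X w * (1 + t * X w) * (1 - t * X w)^-1 ^+ 3 + 2 * n%:R * X w * (1 - t * X w)^-1 ^+ 2
  + n%:R ^+ 2 * X w * (1 - t * X w)^-1 - t * X w * (1 + t * X w) * (1 - t * X w)^-1 ^+ 3
  - (2 * n%:R + 1) * (t * X w) * (1 - t * X w)^-1 ^+ 2 - (n%:R + 2^-1) ^+ 2 * (1 - t * X w)^-1)).
have bg := cbm_geom t2.
have bX := cbm_Xc R.
have bc c := @cbm_cst R c.
have brho n : cbounded_measurable (rho n).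
  by rewrite /rho; cbm.
transitivity (cavg (rho 0%N)).
  rewrite /hypF /hypF1 /hypF2.
  have b3 : cbounded_measurable (fun w => 2 * X w ^+ 2 * (1 - t * X w)^-1 ^+ 3).
    by cbm.
  have b2 : cbounded_measurable (fun w => X w * (1 - t * X w)^-1 ^+ 2).
    by cbm.
  rewrite (_ : _ / 4 = 4^-1 * cavg (fun w => (1 - t * X w)^-1)); last by rewrite mulrC.
  rewrite -(mulNr 4^-1) -!cavgZ// -!cavgD; try by cbm.
  congr cavg; apply/funext => w; rewrite /rho; field.
  exact: geomX_neq0.
(* A generous constant: with N = n + 1, the bracket in [rho] is bounded below by 4 N^2 + 20 N +
   38. *)
apply: (@cavg_eq0_limit _ 200).
- by move=> n; have [] := brho n.
- move=> n.
  transitivity (cavg (fun w => rho n.+1 w + (t ^+ n * n.+1%:R ^+ 2 * X w ^+ n.+1 + (- t ^+ n * (n%:R + 2^-1) ^+ 2) * X w ^+ n))).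
    congr cavg; apply/funext => w; rewrite /rho -[n.+1%:R]natr1 !exprS; field.
    exact: geomX_neq0.
  have bXn c m : cbounded_measurable (fun w => c * X w ^+ m) by cbm.
  rewrite cavgD//; last by apply: cbmD.
  rewrite -[RHS]addr0; congr (_ + _).
  rewrite cavgD// !cavgZ; try exact: cbmX.
  rewrite !cavg_Xc.
  have h (x y : R) : (x ^+ 2 * y)%:C%C = x%:C%C ^+ 2 * y%:C%C :> C by rewrite rmorphM rmorphXn.
  have e : n.+1%:R ^+ 2 * (mom R n.+1)%:C%C = (n%:R + 2^-1) ^+ 2 * (mom R n)%:C%C :> C.
    rewrite -[n.+1%:R](rmorph_nat (@real_complex R)) -[n%:R](rmorph_nat (@real_complex R)).
    rewrite -[2](rmorph_nat (@real_complex R)) -fmorphV -rmorphD -!h momS.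
    by [].
  by rewrite -mulrA e; ring.
- move=> n w.
  have n1 : 1 <= n.+1%:R :> R by rewrite ler1n.
  have nn : n%:R <= n.+1%:R :> R by rewrite ler_nat.
  have n0 : 0 <= n%:R :> R by [].
  have g := geomX_inv_le w t2; have x1 := cabs_Xc w.
  have y1 : cabs (t * X w) <= 1 by rewrite -(mul1r 1); apply: cabsM_le => //; lra.
  have y2 : cabs (1 + t * X w) <= 2 by rewrite (_ : 2 = 1 + 1) //; apply: cabsD_le; rewrite ?cabs1.
  have cn : cabs (n%:R : C) <= n.+1%:R by rewrite cabs_nat.
  have c2 : cabs (2 : C) <= 2 by rewrite cabs_nat.
  have c1 : cabs (1 : C) <= 1 by rewrite cabs1.
  have ch : cabs (2^-1 : C) <= 1 by rewrite cabsV cabs_nat; lra.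
  have bD (a b : C) (A B : R) : cabs a <= A -> cabs b <= B -> cabs (a - b) <= A + B.
    by move=> aA bB; apply: cabsD_le; rewrite ?cabsN.
  set N := (n.+1%:R : R) in n1 nn cn *.
  have big : cabs (X w * (1 + t * X w) * (1 - t * X w)^-1 ^+ 3 + 2 * n%:R * X w * (1 - t * X w)^-1 ^+ 2
  + n%:R ^+ 2 * X w * (1 - t * X w)^-1 - t * X w * (1 + t * X w) * (1 - t * X w)^-1 ^+ 3
  - (2 * n%:R + 1) * (t * X w) * (1 - t * X w)^-1 ^+ 2 - (n%:R + 2^-1) ^+ 2 * (1 - t * X w)^-1)
    <= 1 * 2 * 2 ^+ 3 + 2 * N * 1 * 2 ^+ 2 + N ^+ 2 * 1 * 2 + 1 * 2 * 2 ^+ 3 + (2 * N + 1) * 1 * 2 ^+ 2 + (N + 1) ^+ 2 * 2.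
    by cabs_le.
  have h1 : cabs (t ^+ n) <= (N ^+ 3)^-1 by apply: le_trans (cabs_expn_le n t8) (inv8_le n).
  have h2 : cabs (X w ^+ n) <= 1 by rewrite -(expr1n _ n); exact: cabs_expn_le.
  have := cabsM_le h1 (cabsM_le h2 big) => /le_trans; apply.
  have N3 : 0 < N ^+ 3 by rewrite exprn_gt0//; lra.
  rewrite mulrC ler_pdivrMr// (_ : _ / N * N ^+ 3 = 200 * N ^+ 2); last by field; lra.
  have : N <= N ^+ 2 by rewrite expr2 ler_peMl//; lra.
  have -> : (N + 1) ^+ 2 = N ^+ 2 + 2 * N + 1 by ring.
  lra.
Qed.

(** Half the derivative in v of 2 E log(1 + v Z) = E log(1 - v^2 X). In the series of Z / (1 + v Z)
    the odd powers of Z average to zero and the even ones match the powers of X; [rho n] removes n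
    pairs of consecutive terms. *)
Lemma cavg_Z_X v : cabs v <= 8^-1 ->
  cavg (fun w => Z w * (1 + v * Z w)^-1 + v * X w * (1 - v ^+ 2 * X w)^-1) = 0.
Proof.
move=> v8; have v2 : cabs v <= 2^-1 by lra.
have v22 : cabs (v ^+ 2) <= 2^-1.
  by rewrite expr2; apply: le_trans (cabsM_le v8 v8) _; lra.
pose rho (n : nat) w : C := v ^+ n.*2 * (Z w ^+ n.*2.+1 * (1 + v * Z w)^-1 + v * X w ^+ n.+1 * (1 - v ^+ 2 * X w)^-1).
have bgZ := cbm_geomZ v2; have bgX := cbm_geom v22.
have bX := cbm_Xc R; have bZ := cbm_Zc R.
have bc c := @cbm_cst R c.
have brho n : cbounded_measurable (rho n).
  by rewrite /rho; cbm.
transitivity (cavg (rho 0%N)).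
  by congr cavg; apply/funext => w; rewrite /rho !expr1 mul1r.
apply: (@cavg_eq0_limit _ 4).
- by move=> n; have [] := brho n.
- move=> n.
  transitivity (cavg (fun w => rho n.+1 w + (v ^+ n.*2 * Z w ^+ n.*2.+1
     + ((- v ^+ n.*2.+1) * Z w ^+ n.+1.*2 + v ^+ n.*2.+1 * X w ^+ n.+1)))).
    congr cavg; apply/funext => w; rewrite /rho !doubleS !exprS; field.
    by rewrite geomZ_neq0// geomX_neq0.
  have bXn c m : cbounded_measurable (fun w => c * X w ^+ m) by cbm.
  have bZn c m : cbounded_measurable (fun w => c * Z w ^+ m) by cbm.
  rewrite cavgD//; last by apply: cbmD => //; apply: cbmD.
  rewrite -[RHS]addr0; congr (_ + _).
  rewrite cavgD//; last by apply: cbmD.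
  rewrite cavgD// !cavgZ; try exact: cbmX.
  by rewrite cavg_Zc_odd cavg_Zc_even cavg_Xc; ring.
- move=> n w.
  have h1 : cabs (v ^+ n.*2) <= n.+1%:R^-1.
    apply: le_trans (cabs_expn_le _ v8) _; rewrite -addnn exprD.
    have := inv8_le n; have : (8^-1 : R) ^+ n <= 1 by rewrite exprn_ile1//; lra.
    have p0 : 0 <= (8^-1 : R) ^+ n by rewrite exprn_ge0//; lra.
    have N1 : 1 <= n.+1%:R :> R by rewrite ler1n.
    have : (n.+1%:R ^+ 3)^-1 <= n.+1%:R^-1 :> R.
      rewrite lef_pV2 ?posrE ?exprn_gt0//.
      by rewrite exprS ler_peMr// exprn_ege1.
    move=> n3 P1 P3; apply: le_trans (ler_wpM2l p0 P1) _; rewrite mulr1.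
    exact: le_trans P3 n3.
  have gZ := geomZ_inv_le w v2; have gX := geomX_inv_le w v22.
  have z1 : cabs (Z w ^+ n.*2.+1) <= 1 by rewrite -(expr1n _ n.*2.+1); apply: cabs_expn_le; exact: cabs_Zc.
  have x1 : cabs (X w ^+ n.+1) <= 1 by rewrite -(expr1n _ n.+1); apply: cabs_expn_le; exact: cabs_Xc.
  have v1 : cabs v <= 1 by lra.
  have := cabsM_le h1 (cabsD_le (cabsM_le z1 gZ) (cabsM_le (cabsM_le v1 x1) gX)) => /le_trans; apply.
  by rewrite le_eqVlt; apply/orP; left; apply/eqP; field.
Qed.

End Hypergeometric.

(** * Ramanujan's cubic transformation *)

Section CubicTransformation.
Variable R : realType.
Notation C := R[i].
Notation Om := (R * R)%type.
Notation X := (@Xc R).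
Implicit Types (w : Om) (t p x : C).

Lemma udiff_small (f f' : C -> Om -> C) (e : R) : udiff f f' -> (forall w, f 0 w = 0) -> 0 < e ->
  exists2 r : R, 0 < r & forall p w, cabs p < r -> cabs (f p w) <= e.
Proof.
move=> uf f0 e0; have [r [M [r0 r1 M0 uf1 _]]] := udiff_common uf uf.
exists (Num.min r (e / (3 * M + 1))).
  by rewrite lt_min r0/= divr_gt0//; lra.
move=> p w; rewrite lt_min => /andP[pr]; rewrite ltr_pdivlMr; last by lra.
have := udiff_lipschitz w r1 M0 uf1 (p := 0) (q := p); rewrite cabs0 f0 !subr0 => /(_ r0 pr).
have := cabs_ge0 p; nra.
Qed.

Lemma udiff_1subX (a a' : C -> C) : udiff (fun p (_ : Om) => a p) (fun p _ => a' p) ->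
  udiff (fun p w => 1 - a p * X w) (fun p w => - (a' p * X w)).
Proof.
move=> ua.
apply: udiff_ext (udiffD (udiff_cst 1) (udiffM (udiff_cst (-1)) (udiffM ua (udiff_fun (cbm_Xc R))))) _.
by exists 1 => // p w _; split; ring.
Qed.

Lemma udiff_geom (a a' : C -> C) : udiff (fun p (_ : Om) => a p) (fun p _ => a' p) -> a 0 = 0 ->
  udiff (fun p w => (1 - a p * X w)^-1) (fun p w => a' p * X w * (1 - a p * X w)^-1 ^+ 2).
Proof.
move=> ua a0.
have h w : 1 <= cabs (1 - a 0 * X w) by rewrite a0 mul0r subr0 cabs1.
apply: udiff_ext (udiffV (udiff_1subX ua) ltr01 h) _; exists 1 => // p w _; split => //.
by rewrite opprK exprVn.
Qed.

Lemma udiff_hypF (a a' : C -> C) : udiff (fun p (_ : Om) => a p) (fun p _ => a' p) -> a 0 = 0 ->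
  udiff (fun p (_ : Om) => hypF (a p)) (fun p _ => a' p * hypF1 (a p)).
Proof.
move=> ua a0; have u := udiff_cavg (udiff_geom ua a0).
have h2 : 0 < 2^-1 :> R by rewrite invr_gt0.
have [r r0 ar] := udiff_small ua (fun=> a0) h2.
apply: udiff_ext u _; exists r => // p w pr; split => //.
have bg := cbm_geom (ar _ w pr).
rewrite /hypF1 -cavgZ; last by cbm.
by congr cavg; apply/funext => z; rewrite mulrA.
Qed.

Lemma udiff_hypF1 (a a' : C -> C) : udiff (fun p (_ : Om) => a p) (fun p _ => a' p) -> a 0 = 0 ->
  udiff (fun p (_ : Om) => hypF1 (a p)) (fun p _ => a' p * hypF2 (a p)).
Proof.
move=> ua a0; have ug := udiff_geom ua a0.
have u := udiff_cavg (udiffM (udiff_fun (cbm_Xc R)) (udiffM ug ug)).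
have h2 : 0 < 2^-1 :> R by rewrite invr_gt0.
have [r r0 ar] := udiff_small ua (fun=> a0) h2.
apply: udiff_ext u _; exists r => // p w pr; split => //.
have bg := cbm_geom (ar _ w pr).
rewrite /hypF2 -cavgZ; last by cbm.
by congr cavg; apply/funext => z; ring.
Qed.

(** Self-adjoint form (t (1 - t) F')' = F / 4 of the hypergeometric equation, composed with a. In
    this form no second derivative has to be carried along. *)
Lemma udiff_hypF1_ode (a a' : C -> C) : udiff (fun p (_ : Om) => a p) (fun p _ => a' p) -> a 0 = 0 ->
  udiff (fun p (_ : Om) => a p * (1 - a p) * hypF1 (a p)) (fun p _ => a' p * hypF (a p) / 4).
Proof.
move=> ua a0; have u1 := udiff_hypF1 ua a0.
have u := udiffM (udiffM ua (udiffD (udiff_cst 1) (udiffM (udiff_cst (-1)) ua))) u1.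
have h2 : 0 < 8^-1 :> R by rewrite invr_gt0.
have [r r0 ar] := udiff_small ua (fun=> a0) h2.
apply: udiff_ext u _; exists r => // p w pr; split; first by ring.
have := hypF_ode (ar _ w pr) => /eqP; rewrite subr_eq0 => /eqP e.
by transitivity (a' p * (hypF (a p) / 4)); [rewrite -e; ring|rewrite mulrA].
Qed.

(* Ramanujan's parametrization of the cubic modular equation G3 (al x) (be x) = 0. *)
Definition al x : C := x * (2 + x) ^+ 3 / (1 + 2 * x) ^+ 3.
Definition al' x : C := 2 * (1 - x) ^+ 2 * (2 + x) ^+ 2 / (1 + 2 * x) ^+ 4.
Definition be x : C := x ^+ 3 * (2 + x) / (1 + 2 * x).
Definition be' x : C := 6 * x ^+ 2 * (1 + x) ^+ 2 / (1 + 2 * x) ^+ 2.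

Lemma al0 : al 0 = 0. Proof. by rewrite /al !mul0r. Qed.
Lemma be0 : be 0 = 0. Proof. by rewrite /be expr0n !mul0r. Qed.

Lemma neq0_1D2 p : cabs p < 4^-1 -> 1 + 2 * p != 0.
Proof.
move=> p4; rewrite -cabs_gt0; have := cabs_lower 1 (2 * p).
rewrite cabs1 cabsM cabs_nat; lra.
Qed.

Lemma neq0_1B p : cabs p < 4^-1 -> 1 - p != 0.
Proof.
by move=> p4; rewrite -cabs_gt0; have := cabs_lower 1 (- p); rewrite cabs1 cabsN; lra.
Qed.

Lemma neq0_1D p : cabs p < 4^-1 -> 1 + p != 0.
Proof. by move=> p4; rewrite -cabs_gt0; have := cabs_lower 1 p; rewrite cabs1; lra. Qed.

Lemma neq0_2D p : cabs p < 4^-1 -> 2 + p != 0.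
Proof. by move=> p4; rewrite -cabs_gt0; have := cabs_lower 2 p; rewrite cabs_nat; lra. Qed.

Lemma udiff_lin (a b : C) : udiff (fun p (_ : Om) => a + b * p) (fun _ _ => b).
Proof.
apply: udiff_ext (udiffD (udiff_cst a) (udiffM (udiff_cst b) (udiff_id R))) _.
by exists 1 => // p w _; split; ring.
Qed.

Lemma udiff_V1D2 : udiff (fun p (_ : Om) => (1 + 2 * p)^-1) (fun p _ => - 2 / (1 + 2 * p) ^+ 2).
Proof.
apply: (udiffV (udiff_lin 1 2) ltr01) => w.
by rewrite mulr0 addr0 cabs1.
Qed.

Lemma udiff_al : udiff (fun p (_ : Om) => al p) (fun p _ => al' p).
Proof.
have u2 := udiff_lin 2 1; have uV := udiff_V1D2; have ux := udiff_id R.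
have u := udiffM (udiffM ux (udiffM u2 (udiffM u2 u2))) (udiffM uV (udiffM uV uV)).
apply: udiff_ext u _; exists 4^-1; rewrite ?invr_gt0// => p w /neq0_1D2 p1.
by rewrite /al /al'; split; field.
Qed.

Lemma udiff_be : udiff (fun p (_ : Om) => be p) (fun p _ => be' p).
Proof.
have u2 := udiff_lin 2 1; have uV := udiff_V1D2; have ux := udiff_id R.
have u := udiffM (udiffM (udiffM ux (udiffM ux ux)) u2) uV.
apply: udiff_ext u _; exists 4^-1; rewrite ?invr_gt0// => p w /neq0_1D2 p1.
by rewrite /be /be'; split; field.
Qed.

Lemma hypF0 : hypF (0 : C) = 1.
Proof.
by rewrite /hypF -[RHS](@cavg_cst R); congr cavg; apply/funext => w; rewrite mul0r subr0 invr1.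
Qed.

(* Both sides satisfy the same second-order equation in p, whose Wronskian, multiplied by its
   leading coefficient, is constant and vanishes at the singular point 0. *)
Lemma cubic_transformation :
  exists2 r : R, 0 < r & forall x, cabs x < r -> hypF (al x) = (1 + 2 * x) * hypF (be x).
Proof.
have ua := udiff_al; have ub := udiff_be; have uV := udiff_V1D2; have ux := udiff_id R.
have uu0 := udiff_hypF ua al0; have uv0 := udiff_hypF ub be0.
have uA := udiff_hypF1_ode ua al0; have uB := udiff_hypF1_ode ub be0.
have ul := udiff_lin 1 2.
(* The function is 2 al (1 - al) / al', twice the leading coefficient. It multiplies F(be p) in the
   weighted derivative of (1 + 2 p) F(be p); the other part of that derivative is 3 / (1 + 2 p)
   times be (1 - be) F'(be). *)
have uq1 : udiff (fun p (_ : Om) => p * (1 - p ^+ 2) * (2 + p) / (1 + 2 * p) ^+ 2)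
    (fun p _ => 2 * (1 - p - 3 * p ^+ 2 - 4 * p ^+ 3 - 2 * p ^+ 4) / (1 + 2 * p) ^+ 3).
  have u := udiffM (udiffM ux (udiffM (udiff_lin 1 1) (udiffM (udiff_lin 1 (-1)) (udiff_lin 2 1)))) (udiffM uV uV).
  apply: udiff_ext u _; exists 4^-1; rewrite ?invr_gt0// => p w /neq0_1D2 p1.
  by split; field.
have uW := udiffD (udiffM uA (udiffM ul uv0))
  (udiffM (udiff_cst (-1)) (udiffM uu0 (udiffD (udiffM uq1 uv0) (udiffM (udiffM (udiff_cst 3) uV) uB)))).
have [|r1 r10 W0] := udiff0_cst uW.
  exists 4^-1; rewrite ?invr_gt0// => p w /neq0_1D2 p1 _; rewrite /al /be /al' /be'; field.
  by rewrite p1.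
have ud := udiffM ul uv0.
have hd (w : Om) : 1 <= cabs ((1 + 2 * 0) * hypF (be 0)) by rewrite be0 hypF0 mulr0 addr0 mulr1 cabs1.
have [r2 [_ [r20 _ _ _ dlow]]] := udiff_lower ud ltr01 hd.
(* The Wronskian, divided by the square of the second solution, is the derivative of the quotient of
   the two solutions, and this quotient is 1 at 0. *)
have uR := udiffM uu0 (udiffV ud ltr01 hd).
have [|r3 r30 Rcst] := udiff0_cst uR.
  exists (Num.min (Num.min r1 r2) 4^-1); first by rewrite !lt_min r10 r20 invr_gt0/=.
  move=> p w; rewrite !lt_min => /andP[/andP[pr1 pr2] p4] p0.
  have p1 := neq0_1D2 p4.
  have dn0 : (1 + 2 * p) * hypF (be p) != 0.
    by rewrite -cabs_gt0; apply: lt_le_trans (dlow p w pr2); rewrite divr_gt0.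
  have v0n : hypF (be p) != 0 by move: dn0; rewrite mulf_eq0 negb_or => /andP[].
  have pm := neq0_1B p4; have pp := neq0_1D p4; have p2 := neq0_2D p4.
  have := W0 p w pr1; rewrite [RHS](_ : _ = 0); last first.
    by rewrite al0 be0 expr0n/= !(mul0r, mulr0, addr0, add0r).
  set W := (X in X = 0 -> _) => W0p.
  have WE : W = p * (1 - p) * (1 + p) * (2 + p) / (1 + 2 * p) ^+ 2 / 2 *
      (al' p * hypF1 (al p) * ((1 + 2 * p) * hypF (be p))
       - hypF (al p) * (2 * hypF (be p) + (1 + 2 * p) * (be' p * hypF1 (be p)))).
    by rewrite /W /al /be /al' /be'; field; rewrite p1.
  have : al' p * hypF1 (al p) * ((1 + 2 * p) * hypF (be p))
       - hypF (al p) * (2 * hypF (be p) + (1 + 2 * p) * (be' p * hypF1 (be p))) = 0.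
    apply/eqP; move/eqP: W0p; rewrite WE mulf_eq0 => /orP[|//].
    by rewrite !mulf_eq0 !invr_eq0 expf_eq0 (negbTE p0) (negbTE pm) (negbTE pp) (negbTE p2) (negbTE p1) pnatr_eq0.
  move=> e; rewrite [LHS](_ : _ = (al' p * hypF1 (al p) * ((1 + 2 * p) * hypF (be p))
       - hypF (al p) * (2 * hypF (be p) + (1 + 2 * p) * (be' p * hypF1 (be p)))) / ((1 + 2 * p) * hypF (be p)) ^+ 2).
    by rewrite e mul0r.
  by field; rewrite p1 v0n.
exists r3 => // x xr; have := Rcst x (0, 0) xr.
rewrite al0 be0 hypF0 mulr0 addr0 mulr1 divr1.
have [->|d0] := eqVneq ((1 + 2 * x) * hypF (be x)) 0; first by rewrite invr0 mulr0 => /eqP; rewrite eq_sym oner_eq0.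
by move/(congr1 (fun z => z * ((1 + 2 * x) * hypF (be x)))); rewrite mulfVK// mul1r.
Qed.

End CubicTransformation.

(** * The cubic modular equation as a quartic, and symmetric functions of its roots *)

Section QuarticAlgebra.
Variable R : realType.
Notation C := R[i].
Implicit Types (x y p X B A : C).

(* G3r X B = B^4 G3 X (1/B), which is regular at B = 0. *)
Definition G3r X B : C :=
  (1 + 6 * X * B + X ^+ 2 * B ^+ 2) ^+ 2 - 16 * X * B * (4 * (B + X) - 3 * (X * B + 1)) ^+ 2.
Definition G3r_dB X B : C :=
  2 * (1 + 6 * X * B + X ^+ 2 * B ^+ 2) * (6 * X + 2 * X ^+ 2 * B)
  - 16 * X * (4 * (B + X) - 3 * (X * B + 1)) ^+ 2
  - 32 * X * B * (4 * (B + X) - 3 * (X * B + 1)) * (4 - 3 * X).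
Definition G3r_dX X B : C :=
  2 * (1 + 6 * X * B + X ^+ 2 * B ^+ 2) * (6 * B + 2 * X * B ^+ 2)
  - 16 * B * (4 * (B + X) - 3 * (X * B + 1)) ^+ 2
  - 32 * X * B * (4 * (B + X) - 3 * (X * B + 1)) * (4 - 3 * B).

(** The ratio (al' / al) / (be' / be), that is d log A / d log B along the parametrized curve A = al
    x, B = be x. *)
Definition tau x : C := (1 - x) ^+ 2 / (3 * (1 + x) ^+ 2).

Lemma quartic_eq0 (c0 c1 c2 c3 c4 : C) (s : seq C) : uniq s -> size s = 5 ->
  {in s, forall z, c0 + c1 * z + c2 * z ^+ 2 + c3 * z ^+ 3 + c4 * z ^+ 4 = 0} ->
  [/\ c0 = 0, c1 = 0, c2 = 0, c3 = 0 & c4 = 0].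
Proof.
move=> us s5 rs; pose P := Poly [:: c0; c1; c2; c3; c4].
have P0 : P = 0.
  apply: (roots_geq_poly_eq0 (rs := s)) => //.
    apply/allP => z zs; rewrite /root horner_Poly/=; apply/eqP.
    by rewrite -[RHS](rs z zs); ring.
  by rewrite s5; exact: size_Poly.
have cf i : nth 0 [:: c0; c1; c2; c3; c4] i = 0 by rewrite -coef_Poly -/P P0 coef0.
by split; [exact: (cf 0%N)|exact: (cf 1%N)|exact: (cf 2%N)|exact: (cf 3%N)|exact: (cf 4%N)].
Qed.

Lemma G3r_param x : x != 0 -> 1 + 2 * x != 0 -> 2 + x != 0 -> G3r (al x)^-1 (be x) = 0.
Proof. by move=> h1 h2 h3; rewrite /G3r /al /be; field; rewrite h1 h2 h3. Qed.

(* G3r (1 / al x) (be x) = 0 differentiated in x. *)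
Lemma G3r_dB_param x : x != 0 -> 1 + 2 * x != 0 -> 2 + x != 0 -> 1 + x != 0 ->
  G3r_dB (al x)^-1 (be x) = G3r_dX (al x)^-1 (be x) * (tau x / (al x * be x)).
Proof.
move=> h1 h2 h3 h4; rewrite /G3r_dB /G3r_dX /tau /al /be; field.
by rewrite h1 h2 h3 h4.
Qed.

(** k_j stands for dA_j/dB, and its hypothesis is implicit differentiation of G3r (1/A_j) B = 0.
    Both conclusions equate polynomials of degree at most 4 in X, so agreement at 0 and at the four
    distinct 1/A_j proves them. The second reads as the derivative of the first in B, but B stays
    fixed. *)
Lemma G3r_partial_fractions (A1 A2 A3 A4 k1 k2 k3 k4 B : C) :
  uniq [:: A1; A2; A3; A4] -> 0 \notin [:: A1; A2; A3; A4] ->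
  G3r A1^-1 B = 0 -> G3r A2^-1 B = 0 -> G3r A3^-1 B = 0 -> G3r A4^-1 B = 0 ->
  G3r_dB A1^-1 B = G3r_dX A1^-1 B * (k1 / A1 ^+ 2) -> G3r_dB A2^-1 B = G3r_dX A2^-1 B * (k2 / A2 ^+ 2) ->
  G3r_dB A3^-1 B = G3r_dX A3^-1 B * (k3 / A3 ^+ 2) -> G3r_dB A4^-1 B = G3r_dX A4^-1 B * (k4 / A4 ^+ 2) ->
  forall X, G3r X B = (1 - A1 * X) * (1 - A2 * X) * (1 - A3 * X) * (1 - A4 * X) /\
    G3r_dB X B = - (k1 * X * (1 - A2 * X) * (1 - A3 * X) * (1 - A4 * X)
               + k2 * X * (1 - A1 * X) * (1 - A3 * X) * (1 - A4 * X)
               + k3 * X * (1 - A1 * X) * (1 - A2 * X) * (1 - A4 * X)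
               + k4 * X * (1 - A1 * X) * (1 - A2 * X) * (1 - A3 * X)).
Proof.
move=> uA nA h1 h2 h3 h4 d1 d2 d3 d4.
have [n1 [n2 [n3 n4]]] : A1 != 0 /\ A2 != 0 /\ A3 != 0 /\ A4 != 0.
  by move: nA; rewrite !inE !negb_or !(eq_sym 0) => /and4P[].
pose s := [:: 0; A1^-1; A2^-1; A3^-1; A4^-1].
have us : uniq s.
  have := map_inj_uniq (@invr_inj C) [:: A1; A2; A3; A4]; rewrite uA /s /= => ->.
  by rewrite !inE !negb_or !(eq_sym 0) !invr_eq0 n1 n2 n3 n4.
pose e1 := A1 + A2 + A3 + A4.
pose e2 := A1 * A2 + A1 * A3 + A1 * A4 + A2 * A3 + A2 * A4 + A3 * A4.
pose e3 := A1 * A2 * A3 + A1 * A2 * A4 + A1 * A3 * A4 + A2 * A3 * A4.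
pose e4 := A1 * A2 * A3 * A4.
pose c1 := 12 * B - 16 * B * (4 * B - 3) ^+ 2.
pose c2 := 38 * B ^+ 2 - 32 * B * (4 * B - 3) * (4 - 3 * B).
pose c3 := 12 * B ^+ 3 - 16 * B * (4 - 3 * B) ^+ 2.
have HE X : G3r X B = 1 + c1 * X + c2 * X ^+ 2 + c3 * X ^+ 3 + B ^+ 4 * X ^+ 4.
  by rewrite /G3r /c1 /c2 /c3; ring.
have HXE X : G3r_dX X B = c1 + 2 * c2 * X + 3 * c3 * X ^+ 2 + 4 * B ^+ 4 * X ^+ 3.
  by rewrite /G3r_dX /c1 /c2 /c3; ring.
have PE X : (1 - A1 * X) * (1 - A2 * X) * (1 - A3 * X) * (1 - A4 * X) =
    1 - e1 * X + e2 * X ^+ 2 - e3 * X ^+ 3 + e4 * X ^+ 4.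
  by rewrite /e1 /e2 /e3 /e4; ring.
have [] := @quartic_eq0 0 (c1 + e1) (c2 - e2) (c3 + e3) (B ^+ 4 - e4) s us erefl.
  move=> z zs.
  suff : G3r z B = (1 - A1 * z) * (1 - A2 * z) * (1 - A3 * z) * (1 - A4 * z).
    by rewrite HE PE => /eqP; rewrite -subr_eq0 => /eqP h; rewrite -[RHS]h; ring.
  move: zs; rewrite !inE => /orP[|/orP[|/orP[|/orP[]]]] /eqP ->.
  - by rewrite HE; ring.
  - by rewrite h1 divff// subrr !mul0r.
  - by rewrite h2 [X in _ * X * _ * _](_ : _ = 0) ?divff ?subrr// mulr0 !mul0r.
  - by rewrite h3 [X in _ * X * _](_ : _ = 0) ?divff ?subrr// mulr0 mul0r.
  - by rewrite h4 [X in _ * X](_ : _ = 0) ?divff ?subrr// mulr0.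
move=> _ /eqP q1 /eqP q2 /eqP q3 /eqP q4.
move: q1 q2 q3 q4; rewrite addr_eq0 subr_eq0 addr_eq0 subr_eq0 => /eqP q1 /eqP q2 /eqP q3 /eqP q4.
pose KK X := k1 * X * (1 - A2 * X) * (1 - A3 * X) * (1 - A4 * X)
               + k2 * X * (1 - A1 * X) * (1 - A3 * X) * (1 - A4 * X)
               + k3 * X * (1 - A1 * X) * (1 - A2 * X) * (1 - A4 * X)
               + k4 * X * (1 - A1 * X) * (1 - A2 * X) * (1 - A3 * X).
pose b1 := 12 - 16 * (4 * B - 3) ^+ 2 - 128 * B * (4 * B - 3).
pose b2 := 76 * B - 32 * (4 * B - 3) * (4 - 3 * B) - 32 * B * (4 * (4 - 3 * B) - 3 * (4 * B - 3)).
pose b3 := 36 * B ^+ 2 - 16 * (4 - 3 * B) ^+ 2 + 96 * B * (4 - 3 * B).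
have HBE X : G3r_dB X B = b1 * X + b2 * X ^+ 2 + b3 * X ^+ 3 + 4 * B ^+ 3 * X ^+ 4.
  by rewrite /G3r_dB /b1 /b2 /b3; ring.
pose m1 := k1 + k2 + k3 + k4.
pose m2 := k1 * (A2 + A3 + A4) + k2 * (A1 + A3 + A4) + k3 * (A1 + A2 + A4) + k4 * (A1 + A2 + A3).
pose m3 := k1 * (A2 * A3 + A2 * A4 + A3 * A4) + k2 * (A1 * A3 + A1 * A4 + A3 * A4)
   + k3 * (A1 * A2 + A1 * A4 + A2 * A4) + k4 * (A1 * A2 + A1 * A3 + A2 * A3).
pose m4 := k1 * (A2 * A3 * A4) + k2 * (A1 * A3 * A4) + k3 * (A1 * A2 * A4) + k4 * (A1 * A2 * A3).
have KE X : KK X = m1 * X - m2 * X ^+ 2 + m3 * X ^+ 3 - m4 * X ^+ 4.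
  by rewrite /KK /m1 /m2 /m3 /m4; ring.
have [] := @quartic_eq0 0 (b1 + m1) (b2 - m2) (b3 + m3) (4 * B ^+ 3 - m4) s us erefl.
  move=> z zs.
  suff : G3r_dB z B = - KK z.
    by rewrite HBE KE => /eqP; rewrite -subr_eq0 => /eqP h; rewrite -[RHS]h; ring.
  move: zs; rewrite !inE => /orP[|/orP[|/orP[|/orP[]]]] /eqP ->.
  - by rewrite HBE /KK; ring.
  - rewrite d1 HXE q1 q2 q3 q4 /KK /e1 /e2 /e3 /e4; field; by rewrite n1.
  - rewrite d2 HXE q1 q2 q3 q4 /KK /e1 /e2 /e3 /e4; field; by rewrite n2.
  - rewrite d3 HXE q1 q2 q3 q4 /KK /e1 /e2 /e3 /e4; field; by rewrite n3.
  - rewrite d4 HXE q1 q2 q3 q4 /KK /e1 /e2 /e3 /e4; field; by rewrite n4.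
move=> _ /eqP r1 /eqP r2 /eqP r3 /eqP r4.
move: r1 r2 r3 r4; rewrite addr_eq0 subr_eq0 addr_eq0 subr_eq0 => /eqP r1 /eqP r2 /eqP r3 /eqP r4 X.
split; first by rewrite HE PE q1 q2 q3 q4; ring.
by rewrite HBE -/(KK X) KE r1 r2 r3 r4; ring.
Qed.

(** In v = 1 / (1 + x), 3 tau x = (2 v - 1)^2, and 3 tau x (1 + 2 x) is 2 x plus a quadratic
    polynomial in v. So only the sums of x, v and v^2 are required; the quartic gives the v_j the
    sum 2 and the second symmetric function 0. *)
Lemma sum_tau (x1 x2 x3 x4 B : C) :
  x1 + x2 + x3 + x4 = - 2 ->
  x1 * x2 + x1 * x3 + x1 * x4 + x2 * x3 + x2 * x4 + x3 * x4 = 0 ->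
  x1 * x2 * x3 + x1 * x2 * x4 + x1 * x3 * x4 + x2 * x3 * x4 = 2 * B ->
  x1 * x2 * x3 * x4 = - B ->
  1 + x1 != 0 -> 1 + x2 != 0 -> 1 + x3 != 0 -> 1 + x4 != 0 ->
  tau x1 + tau x2 + tau x3 + tau x4 = 4 /\
  tau x1 * (1 + 2 * x1) + tau x2 * (1 + 2 * x2) + tau x3 * (1 + 2 * x3) + tau x4 * (1 + 2 * x4) = - 8.
Proof.
move=> e1 e2 e3 e4 n1 n2 n3 n4.
pose v1 := (1 + x1)^-1; pose v2 := (1 + x2)^-1; pose v3 := (1 + x3)^-1; pose v4 := (1 + x4)^-1.
pose u4 := (1 + x1) * (1 + x2) * (1 + x3) * (1 + x4).
have u4n : u4 != 0 by rewrite !mulf_neq0.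
have u4E : u4 = B - 1.
  rewrite (_ : u4 = 1 + (x1 + x2 + x3 + x4) + (x1 * x2 + x1 * x3 + x1 * x4 + x2 * x3 + x2 * x4 + x3 * x4)
    + (x1 * x2 * x3 + x1 * x2 * x4 + x1 * x3 * x4 + x2 * x3 * x4) + x1 * x2 * x3 * x4); last by rewrite /u4; ring.
  by rewrite e1 e2 e3 e4; ring.
have s1 : v1 + v2 + v3 + v4 = 2.
  apply: (mulIf u4n); rewrite (_ : (v1 + v2 + v3 + v4) * u4 = 4 + 3 * (x1 + x2 + x3 + x4)
     + 2 * (x1 * x2 + x1 * x3 + x1 * x4 + x2 * x3 + x2 * x4 + x3 * x4)
     + (x1 * x2 * x3 + x1 * x2 * x4 + x1 * x3 * x4 + x2 * x3 * x4)); last first.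
    by rewrite /v1 /v2 /v3 /v4 /u4; field; rewrite n1 n2 n3 n4.
  by rewrite e1 e2 e3 u4E; ring.
have s2 : v1 * v2 + v1 * v3 + v1 * v4 + v2 * v3 + v2 * v4 + v3 * v4 = 0.
  apply: (mulIf u4n); rewrite (_ : (v1 * v2 + v1 * v3 + v1 * v4 + v2 * v3 + v2 * v4 + v3 * v4) * u4 = 6 + 3 * (x1 + x2 + x3 + x4)
     + (x1 * x2 + x1 * x3 + x1 * x4 + x2 * x3 + x2 * x4 + x3 * x4)); last first.
    by rewrite /v1 /v2 /v3 /v4 /u4; field; rewrite n1 n2 n3 n4.
  by rewrite e1 e2 mul0r; ring.
have s3 : v1 ^+ 2 + v2 ^+ 2 + v3 ^+ 2 + v4 ^+ 2 = 4.
  rewrite [LHS](_ : _ = (v1 + v2 + v3 + v4) ^+ 2 - 2 * (v1 * v2 + v1 * v3 + v1 * v4 + v2 * v3 + v2 * v4 + v3 * v4)); last by ring.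
  by rewrite s1 s2; ring.
have tE x : 1 + x != 0 -> tau x = (4 * (1 + x)^-1 ^+ 2 - 4 * (1 + x)^-1 + 1) / 3.
  by move=> n; rewrite /tau; field.
have tE' x : 1 + x != 0 -> tau x * (1 + 2 * x) = (2 * x - 7 + 12 * (1 + x)^-1 - 4 * (1 + x)^-1 ^+ 2) / 3.
  by move=> n; rewrite /tau; field.
rewrite !tE'// !tE// -/v1 -/v2 -/v3 -/v4; split.
  rewrite [LHS](_ : _ = (4 * (v1 ^+ 2 + v2 ^+ 2 + v3 ^+ 2 + v4 ^+ 2) - 4 * (v1 + v2 + v3 + v4) + 4) / 3); last by field.
  by rewrite s1 s3; field.
rewrite [LHS](_ : _ = (2 * (x1 + x2 + x3 + x4) - 28 + 12 * (v1 + v2 + v3 + v4) - 4 * (v1 ^+ 2 + v2 ^+ 2 + v3 ^+ 2 + v4 ^+ 2)) / 3); last by field.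
by rewrite s1 s3 e1; field.
Qed.

End QuarticAlgebra.

(** * Existence and smallness of the roots, local injectivity of [al] *)

Section RootsAverage.
Variable R : realType.
Notation C := R[i].
Notation Om := (R * R)%type.
Notation X := (@Xc R).
Implicit Types (x y p B A : C) (w : Om).

(** One root of the cubic and one of its quadratic quotient exist by algebraic closedness; the sum
    determines the third. Vieta's relations are the form in which the roots are used later. *)
Lemma cubic_roots (b c d : C) : exists x2 x3 x4 : C,
  [/\ x2 + x3 + x4 = - b, x2 * x3 + x2 * x4 + x3 * x4 = c & x2 * x3 * x4 = - d].
Proof.
have [x2 h2] := @solve_monicpoly C 3 (fun i => nth 0 [:: - d; - c; - b] i) isT.
rewrite !big_ord_recl big_ord0 /= expr0 /bump/= in h2.
have [x3 h3] := @solve_monicpoly C 2 (fun i => nth 0 [:: - (c + x2 * (b + x2)); - (b + x2)] i) isT.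
rewrite !big_ord_recl big_ord0 /= expr0 /bump/= in h3.
exists x2, x3, (- (b + x2) - x3).
have e3 : x3 * (- (b + x2) - x3) = c + x2 * (b + x2).
  by rewrite mulrBr -expr2 h3; ring.
split; first by ring.
  by rewrite e3; ring.
rewrite -mulrA e3.
have -> : - d = x2 ^+ 3 + b * x2 ^+ 2 + c * x2 by rewrite h2; ring.
by ring.
Qed.

(** If |x| >= e, the lower terms amount to at most (3/4) e^3 when |x| <= 1, and to at most (3/4)
    |x|^3 otherwise; neither can balance x^3. *)
Lemma small_cubic_root (b c d x : C) (e : R) : 0 < e -> e <= 1 ->
  cabs b <= e ^+ 3 / 4 -> cabs c <= e ^+ 3 / 4 -> cabs d <= e ^+ 3 / 4 ->
  x ^+ 3 + b * x ^+ 2 + c * x + d = 0 -> cabs x < e.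
Proof.
move=> e0 e1 hb hc hd hx; rewrite ltNge; apply/negP => ex.
have x0 := cabs_ge0 x.
have x3 : cabs x ^+ 3 <= e ^+ 3 / 4 * (cabs x ^+ 2 + cabs x + 1).
  rewrite -cabsX (_ : x ^+ 3 = - (b * x ^+ 2 + c * x + d)).
    rewrite cabsN !mulrDr mulr1; apply: cabsD_le => //; apply: cabsD_le.
      by apply: cabsM_le => //; rewrite cabsX.
    exact: cabsM_le.
  by apply/eqP; rewrite -addr_eq0 !addrA hx.
have e3 : 0 < e ^+ 3 by rewrite exprn_gt0.
have ee : e ^+ 3 <= cabs x ^+ 3 by apply: lerXn2r => //; rewrite nnegrE// ltW.
have ee1 : e ^+ 3 <= 1 by rewrite exprn_ile1// ltW.
have [t1|t1] := lerP (cabs x) 1.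
  have : cabs x ^+ 2 <= 1 by rewrite exprn_ile1.
  move: x3 ee; set t3 := cabs x ^+ 3; set t2 := cabs x ^+ 2 => x3 ee t2l.
  have : e ^+ 3 / 4 * (t2 + cabs x + 1) <= e ^+ 3 / 4 * 3 by rewrite ler_wpM2l//; lra.
  lra.
have t2 : cabs x <= cabs x ^+ 2 by rewrite expr2 ler_peMl// ltW.
have t3 : cabs x ^+ 2 <= cabs x ^+ 3 by rewrite [leRHS]exprS ler_peMl ?exprn_ge0 ?(ltW t1).
have : e ^+ 3 / 4 * (cabs x ^+ 2 + cabs x + 1) <= 4^-1 * (3 * cabs x ^+ 3).
  by apply: ler_pM; lra.
by move: x3 t1 t2 t3 => *; lra.
Qed.

Lemma cabs_al'_ge x : cabs x < 4^-1 -> 2^-1 <= cabs (al' x).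
Proof.
move=> x4; have p1 := neq0_1D2 x4.
have h1 : 3 / 4 <= cabs (1 - x) by have := cabs_lower 1 (- x); rewrite cabs1 cabsN; lra.
have h2 : 7 / 4 <= cabs (2 + x) by have := cabs_lower 2 x; rewrite cabs_nat; lra.
have h3 : cabs (1 + 2 * x) <= 3 / 2.
  by apply: le_trans (cabsD _ _) _; rewrite cabs1 cabsM cabs_nat; lra.
have h30 : 0 < cabs (1 + 2 * x) by rewrite cabs_gt0.
rewrite /al' cabsM cabsV cabsX cabsM cabsX cabsM cabsX cabs_nat ler_pdivlMr ?exprn_gt0//.
have k1 : (3 / 4) ^+ 2 <= cabs (1 - x) ^+ 2 by apply: lerXn2r => //; rewrite nnegrE; lra.
have k2 : (7 / 4) ^+ 2 <= cabs (2 + x) ^+ 2 by apply: lerXn2r => //; rewrite nnegrE; lra.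
have k3 : cabs (1 + 2 * x) ^+ 4 <= (3 / 2) ^+ 4 by apply: lerXn2r => //; rewrite nnegrE; lra.
have k4 : 2 * (3 / 4) ^+ 2 * (7 / 4) ^+ 2 <= 2 * cabs (1 - x) ^+ 2 * cabs (2 + x) ^+ 2.
  by apply: ler_pM => //; rewrite ler_pM2l.
by apply: le_trans k4; apply: le_trans (ler_wpM2l _ k3) _; lra.
Qed.

(** If al x = al y, the expansion at x gives |al' x| |y - x| <= M |y - x|^2. With |al' x| >= 1/2 and
    M |y - x| <= 1/4, which the radius 1 / (8 M + 1) ensures, this forces y = x. *)
Lemma al_inj : exists2 r : R, 0 < r & forall x y, cabs x < r -> cabs y < r -> al x = al y -> x = y.
Proof.
have [r [M [r0 r1 M0 [_ _ df] _]]] := udiff_common (udiff_al R) (udiff_al R).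
exists (Num.min (Num.min r 4^-1) (8 * M + 1)^-1).
  by rewrite !lt_min r0 !invr_gt0; lra.
move=> x y; rewrite !lt_min => /andP[/andP[xr x4] xM] /andP[/andP[yr y4] yM] e.
apply/eqP; rewrite eq_sym -subr_eq0 -cabs_eq0; apply: contraT => yx0.
have k0 : 0 < cabs (y - x) by rewrite lt_def yx0 cabs_ge0.
have := df x y (0, 0) xr yr; rewrite e subrr sub0r cabsN cabsM expr2 mulrCA ler_pM2l//.
have := cabs_al'_ge x4 => h1 h2.
have M1 : 0 < 8 * M + 1 by lra.
have k1 : cabs (y - x) <= 2 * (8 * M + 1)^-1.
  by apply: le_trans (cabsB _ _) _; lra.
have k2 : M * cabs (y - x) <= 4^-1.
  apply: le_trans (ler_wpM2l M0 k1) _; rewrite mulrA ler_pdivrMr//; lra.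
lra.
Qed.

Lemma al_small (e : R) : 0 < e -> exists2 r : R, 0 < r & forall x, cabs x < r -> cabs (al x) <= e.
Proof.
move=> e0; have [r r0 h] := udiff_small (udiff_al R) (fun=> al0 R) e0.
by exists r => // x; exact: h x (0, 0).
Qed.

Lemma be_small (e : R) : 0 < e -> exists2 r : R, 0 < r & forall x, cabs x < r -> cabs (be x) <= e.
Proof.
move=> e0; have [r r0 h] := udiff_small (udiff_be R) (fun=> be0 R) e0.
by exists r => // x; exact: h x (0, 0).
Qed.

End RootsAverage.

(** * Average of the logarithmic derivative of [G3r] in B *)

Section LogDerivative.
Variable R : realType.
Notation C := R[i].
Notation Om := (R * R)%type.
Notation X := (@Xc R).
Implicit Types (x y p B A : C) (w : Om).

Lemma root_quartic (x x1 x2 x3 x4 B : C) :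
  x1 + x2 + x3 + x4 = - 2 ->
  x1 * x2 + x1 * x3 + x1 * x4 + x2 * x3 + x2 * x4 + x3 * x4 = 0 ->
  x1 * x2 * x3 + x1 * x2 * x4 + x1 * x3 * x4 + x2 * x3 * x4 = 2 * B ->
  x1 * x2 * x3 * x4 = - B ->
  (x - x1) * (x - x2) * (x - x3) * (x - x4) = x ^+ 3 * (2 + x) - B * (1 + 2 * x).
Proof.
move=> e1 e2 e3 e4.
rewrite [LHS](_ : _ = x ^+ 4 - (x1 + x2 + x3 + x4) * x ^+ 3
  + (x1 * x2 + x1 * x3 + x1 * x4 + x2 * x3 + x2 * x4 + x3 * x4) * x ^+ 2
  - (x1 * x2 * x3 + x1 * x2 * x4 + x1 * x3 * x4 + x2 * x3 * x4) * x + x1 * x2 * x3 * x4); last by ring.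
by rewrite e1 e2 e3 e4; ring.
Qed.

(** A double root kills Q = x^3 (2 + x) - B (1 + 2 x) and its derivative Q'. The combination (1 + 2
    x) Q' - 2 Q eliminates B and leaves 6 x^2 (1 + x)^2, the numerator of [be']. *)
Lemma quartic_double_root (x y z B : C) :
  x + x + y + z = - 2 ->
  x * x + x * y + x * z + x * y + x * z + y * z = 0 ->
  x * x * y + x * x * z + x * y * z + x * y * z = 2 * B ->
  x * x * y * z = - B -> x = 0 \/ x = -1.
Proof.
move=> e1 e2 e3 e4.
have h1 : x ^+ 3 * (2 + x) - B * (1 + 2 * x) = 0.
  by rewrite -(@root_quartic x x x y z B e1 e2 e3 e4) subrr !mul0r.
have h2 : 4 * x ^+ 3 + 6 * x ^+ 2 - 2 * B = 0.
  rewrite -e3 (_ : 6 = - (- 2) * 3); last by ring.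
  rewrite -e1 -[RHS](mulr0 (- 2 * x)) -[in RHS]e2; ring.
have : 6 * x ^+ 2 * (1 + x) ^+ 2 = 0.
  rewrite [LHS](_ : _ = (1 + 2 * x) * (4 * x ^+ 3 + 6 * x ^+ 2 - 2 * B)
     - 2 * (x ^+ 3 * (2 + x) - B * (1 + 2 * x))); last by ring.
  by rewrite h1 h2; ring.
move=> /eqP; rewrite !mulf_eq0 !orbb pnatr_eq0/= => /orP[|] /eqP h; first by left.
by right; apply/eqP; rewrite -addr_eq0 addrC h.
Qed.

(** These are the coefficients of the cubic left when the root - (2 + p) / (1 + 2 p) is divided out
    of the quartic with B = al p. The constant 27 = 3 (9/4) 2^2 comes from the middle one. *)
Lemma cubic_coefs_small p : cabs p < 4^-1 ->
  [/\ cabs (3 * p / (1 + 2 * p)) <= 27 * cabs p,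
      cabs (- (3 * p * (2 + p)) / (1 + 2 * p) ^+ 2) <= 27 * cabs p &
      cabs (- (p * (2 + p) ^+ 2) / (1 + 2 * p) ^+ 2) <= 27 * cabs p].
Proof.
move=> p4; have p0 := cabs_ge0 p.
have h1 : 2^-1 <= cabs (1 + 2 * p).
  by have := cabs_lower 1 (2 * p); rewrite cabs1 cabsM cabs_nat; lra.
have h2 : cabs (2 + p) <= 9 / 4 by apply: le_trans (cabsD _ _) _; rewrite cabs_nat; lra.
have h3 : cabs (1 + 2 * p)^-1 <= 2.
  by rewrite cabsV -[leRHS]invrK lef_pV2 ?posrE//; lra.
have h4 : cabs (3 : C) <= 3 by rewrite cabs_nat.
have h5 : cabs p <= cabs p by [].
rewrite -!exprVn; split.
- have : cabs (3 * p / (1 + 2 * p)) <= 3 * cabs p * 2 by cabs_le.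
  by move=> /le_trans; apply; lra.
- have : cabs (3 * p * (2 + p) * (1 + 2 * p)^-1 ^+ 2) <= 3 * cabs p * (9 / 4) * 2 ^+ 2 by cabs_le.
  by rewrite -cabsN -mulNr => /le_trans; apply; lra.
- have : cabs (p * (2 + p) ^+ 2 * (1 + 2 * p)^-1 ^+ 2) <= cabs p * (9 / 4) ^+ 2 * 2 ^+ 2 by cabs_le.
  by rewrite -cabsN -mulNr => /le_trans; apply; lra.
Qed.

(* The quotients al x / be x and be p / al p = al x1 / be x1 for x1 = - (2 + p) / (1 + 2 p)
   have different sizes. *)
Lemma al_be_neq x p : cabs x < 4^-1 -> cabs p < 4^-1 -> x != 0 -> p != 0 ->
  al x = be p -> be x = al p -> False.
Proof.
move=> x4 p4 x0 p0 e1 e2.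
have x1 := neq0_1D2 x4; have p1 := neq0_1D2 p4; have x2 := neq0_2D x4; have p2 := neq0_2D p4.
have : al x * al p = be x * be p by rewrite e1 e2 mulrC.
move=> e.
have : ((2 + x) * (2 + p)) ^+ 2 = (x * (1 + 2 * x) * (p * (1 + 2 * p))) ^+ 2.
  have nz : x * p * (2 + x) * (2 + p) / ((1 + 2 * x) ^+ 3 * (1 + 2 * p) ^+ 3) != 0.
    by rewrite !mulf_neq0// invr_eq0 mulf_neq0// expf_neq0.
  apply: (mulfI nz).
  transitivity (al x * al p); first by rewrite /al; field; rewrite x1 p1.
  by rewrite e /be; field; rewrite x1 p1.
move/(congr1 (@cabs R)); rewrite !cabsX => h.
have b1 : 1 < cabs ((2 + x) * (2 + p)).
  have : 7 / 4 <= cabs (2 + x) by have := cabs_lower 2 x; rewrite cabs_nat; lra.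
  have : 7 / 4 <= cabs (2 + p) by have := cabs_lower 2 p; rewrite cabs_nat; lra.
  by rewrite cabsM; nra.
have b2 z : cabs z < 4^-1 -> cabs (z * (1 + 2 * z)) <= 1.
  move=> z4; have h1 : cabs (1 + 2 * z) <= 2.
    by apply: le_trans (cabsD _ _) _; rewrite cabs1 cabsM cabs_nat; lra.
  by apply: le_trans (cabsM_le (ltW z4) h1) _; lra.
have b3 : cabs (x * (1 + 2 * x) * (p * (1 + 2 * p))) <= 1.
  by rewrite cabsM -[leRHS]mulr1 ler_pM ?cabs_ge0 ?b2.
have : 1 < cabs ((2 + x) * (2 + p)) ^+ 2 by rewrite exprn_egt1.
rewrite h ltNge => /negP; apply.
by rewrite exprn_ile1// cabs_ge0.
Qed.

(** Partial fractions turn the left side into the sum of tau x_j (1 - F(A_j)), and the tau x_j add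
    up to 4. For the small roots F(A_j) = (1 + 2 x_j) F(B), so [sum_tau] gives 8 F(B) plus a
    multiple of tau x_1. As F(B) = (1 + 2 p) F(be p), that multiple is - 3 tau x_1 F(be p), which
    joins - tau x_1 F(be p) from the remaining root. *)
Lemma cavg_log_derivative : exists2 r : R, 0 < r & forall p, 0 < cabs p -> cabs p < r ->
  al p * cavg (fun w => G3r_dB (X w) (al p) / G3r (X w) (al p)) =
  8 * hypF (al p) - 4 * (3 * (1 + p) ^+ 2 / (1 - p) ^+ 2) * hypF (be p) + 4.
Proof.
have [rT rT0 hT] := cubic_transformation R.
have [ri ri0 hi] := al_inj R.
have h2 : 0 < 2^-1 :> R by rewrite invr_gt0.
have [ra ra0 ha] := @al_small R _ h2.
have [rb rb0 hb] := @be_small R _ h2.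
pose e := Num.min (Num.min rT ri) (Num.min ra 4^-1).
have e0 : 0 < e by rewrite !lt_min rT0 ri0 ra0 invr_gt0/=.
have eT x : cabs x < e -> cabs x < rT by rewrite /e !lt_min => /andP[/andP[]].
have ei x : cabs x < e -> cabs x < ri by rewrite /e !lt_min => /andP[/andP[]].
have ea x : cabs x < e -> cabs x < ra by rewrite /e !lt_min => /andP[_ /andP[]].
have e4 x : cabs x < e -> cabs x < 4^-1 by rewrite /e !lt_min => /andP[_ /andP[]].
have e1 : e <= 1.
  have : e <= 4^-1 by rewrite /e !ge_min lexx !orbT.
  by move/le_trans; apply; lra.
have e3 : 0 < e ^+ 3 / 4 / 27 by rewrite !divr_gt0// exprn_gt0.
exists (Num.min (Num.min e rb) (e ^+ 3 / 4 / 27)); first by rewrite lt_min e3 andbT lt_min e0 rb0.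
move=> p; rewrite cabs_gt0 => p0; rewrite lt_min => /andP[]; rewrite lt_min => /andP[pe pb] p27.
have p4 := e4 p pe; have [sb sc sd] := cubic_coefs_small p4.
have p1 := neq0_1D2 p4; have p2 := neq0_2D p4; have pm := neq0_1B p4; have pp := neq0_1D p4.
have p27' : 27 * cabs p <= e ^+ 3 / 4.
  by rewrite mulrC -ler_pdivlMr// ltW.
set B := al p.
have B0 : B != 0 by rewrite /B /al !mulf_neq0 ?invr_eq0 ?expf_neq0.
set b := 3 * p / (1 + 2 * p) in sb.
set c := - (3 * p * (2 + p)) / (1 + 2 * p) ^+ 2 in sc.
set d := - (p * (2 + p) ^+ 2) / (1 + 2 * p) ^+ 2 in sd.
(* x2, x3, x4 and x1 := - (2 + p) / (1 + 2 p) are the roots of x^3 (2 + x) = B (1 + 2 x);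
   the first three are small, so that the cubic transformation applies to them, and al x1 = be p. *)
have [x2 [x3 [x4 [v1 v2 v3]]]] := cubic_roots b c d.
have cub x : (x - x2) * (x - x3) * (x - x4) = 0 -> cabs x < e.
  move=> hx; apply: (small_cubic_root e0 e1 (le_trans sb p27') (le_trans sc p27') (le_trans sd p27')).
  have bE : b = - (x2 + x3 + x4) by rewrite v1 opprK.
  have dE : d = - (x2 * x3 * x4) by rewrite v3 opprK.
  by rewrite -[RHS]hx -v2 bE dE; ring.
have x2e : cabs x2 < e by apply: cub; rewrite subrr !mul0r.
have x3e : cabs x3 < e by apply: cub; rewrite subrr mulr0 mul0r.
have x4e : cabs x4 < e by apply: cub; rewrite subrr mulr0.
set x1 := - (2 + p) / (1 + 2 * p).
have s1 : x1 + x2 + x3 + x4 = - 2.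
  by rewrite -!addrA [x2 + _]addrA v1 /x1 /b; field.
have s2 : x1 * x2 + x1 * x3 + x1 * x4 + x2 * x3 + x2 * x4 + x3 * x4 = 0.
  rewrite [LHS](_ : _ = x1 * (x2 + x3 + x4) + (x2 * x3 + x2 * x4 + x3 * x4)); last by ring.
  by rewrite v1 v2 /x1 /b /c; field.
have s3 : x1 * x2 * x3 + x1 * x2 * x4 + x1 * x3 * x4 + x2 * x3 * x4 = 2 * B.
  rewrite [LHS](_ : _ = x1 * (x2 * x3 + x2 * x4 + x3 * x4) + x2 * x3 * x4); last by ring.
  by rewrite v2 v3 /x1 /c /d /B /al; field.
have s4 : x1 * x2 * x3 * x4 = - B.
  rewrite -!mulrA [x2 * _]mulrA v3 /x1 /d /B /al; field.
  exact: p1.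
have q := root_quartic _ s1 s2 s3 s4.
have x1n : x1 != 0 by rewrite /x1 mulf_neq0 ?invr_eq0 ?oppr_eq0.
have xn y : (y - x1) * (y - x2) * (y - x3) * (y - x4) = 0 -> y != 0.
  rewrite q => h; apply/eqP => y0; move: h; rewrite y0 expr0n mul0r sub0r mulr0 addr0 mulr1.
  by move/eqP; rewrite oppr_eq0 (negbTE B0).
have x2n : x2 != 0 by apply: xn; rewrite subrr mulr0 !mul0r.
have x3n : x3 != 0 by apply: xn; rewrite subrr mulr0 !mul0r.
have x4n : x4 != 0 by apply: xn; rewrite subrr mulr0.
have beB y : (y - x1) * (y - x2) * (y - x3) * (y - x4) = 0 -> cabs y < e -> be y = B.
  rewrite q => /eqP; rewrite subr_eq0 => /eqP h ye; rewrite /be h mulfK//.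
  by apply: neq0_1D2; exact: e4.
have be2 : be x2 = B by apply: beB => //; rewrite subrr mulr0 !mul0r.
have be3 : be x3 = B by apply: beB => //; rewrite subrr mulr0 !mul0r.
have be4 : be x4 = B by apply: beB => //; rewrite subrr mulr0.
have l1 : 1 + 2 * x1 = - 3 / (1 + 2 * p) by rewrite /x1; field.
have l2 : 2 + x1 = 3 * p / (1 + 2 * p) by rewrite /x1; field.
have l3 : 1 + x1 = - (1 - p) / (1 + 2 * p) by rewrite /x1; field.
have be1 : be x1 = B.
  by rewrite /be l1 l2 /x1 /B /al; field; rewrite p1.
have al1 : al x1 = be p.
  by rewrite /al l1 l2 /x1 /be; field; rewrite p1.
have n3 : 3 != 0 :> C by rewrite pnatr_eq0.
have l1n : 1 + 2 * x1 != 0 by rewrite l1 mulf_neq0 ?invr_eq0 ?oppr_eq0.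
have l2n : 2 + x1 != 0 by rewrite l2 !mulf_neq0 ?invr_eq0.
have l3n : 1 + x1 != 0 by rewrite l3 !mulf_neq0 ?invr_eq0 ?oppr_eq0.
have x2m := e4 _ x2e; have x3m := e4 _ x3e; have x4m := e4 _ x4e.
(* A small nonzero number cannot be a double root, since a double root is 0 or - 1. *)
have dbl (x y z : C) : cabs x < 4^-1 -> x != 0 ->
  x + x + y + z = - 2 ->
  x * x + x * y + x * z + x * y + x * z + y * z = 0 ->
  x * x * y + x * x * z + x * y * z + x * y * z = 2 * B ->
  x * x * y * z = - B -> False.
  move=> xs xn0 h1 h2' h3 h4; have [|] := quartic_double_root h1 h2' h3 h4; first by apply/eqP.
  by move=> xE; move: (neq0_1D xs); rewrite xE subrr eqxx.
have x23 : x2 != x3.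
  apply/eqP => E; apply: (dbl x2 x1 x4) => //; rewrite -?s1 -?s2 -?s3 -?s4 -?E; ring.
have x24 : x2 != x4.
  apply/eqP => E; apply: (dbl x2 x1 x3) => //; rewrite -?s1 -?s2 -?s3 -?s4 -?E; ring.
have x34 : x3 != x4.
  apply/eqP => E; apply: (dbl x3 x1 x2) => //; rewrite -?s1 -?s2 -?s3 -?s4 -?E; ring.
have aln x : cabs x < 4^-1 -> x != 0 -> al x != 0.
  move=> xs xn0; have := neq0_1D2 xs; have := neq0_2D xs => ? ?.
  by rewrite /al !mulf_neq0 ?invr_eq0 ?expf_neq0.
have al1n : al x1 != 0 by rewrite al1 /be !mulf_neq0 ?invr_eq0 ?expf_neq0.
(* [al] is injective on the small roots; the large root x1 is separated from them by [al_be_neq]. *)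
have uA : uniq [:: al x1; al x2; al x3; al x4].
  have inj x y : cabs x < e -> cabs y < e -> x != y -> al x != al y.
    by move=> xe ye; apply: contra => /eqP /(hi _ _ (ei _ xe) (ei _ ye)) ->.
  have out x : cabs x < 4^-1 -> x != 0 -> be x = B -> al x1 != al x.
    by move=> xs xn0 xB; rewrite al1 eq_sym; apply/eqP => E; exact: (al_be_neq xs p4 xn0 p0 E xB).
  by rewrite /= !inE !negb_or (out x2)// (out x3)// (out x4)// (inj x2 x3)// (inj x2 x4)// (inj x3 x4).
have nA : 0 \notin [:: al x1; al x2; al x3; al x4].
  by rewrite !inE !negb_or !(eq_sym 0) al1n !aln.
have HHx x : x != 0 -> 1 + 2 * x != 0 -> 2 + x != 0 -> be x = B -> G3r (al x)^-1 B = 0.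
  by move=> g1 g2 g3 <-; exact: G3r_param.
have HHBx x : x != 0 -> 1 + 2 * x != 0 -> 2 + x != 0 -> 1 + x != 0 -> al x != 0 -> be x = B ->
    G3r_dB (al x)^-1 B = G3r_dX (al x)^-1 B * (tau x * al x / B / al x ^+ 2).
  move=> g1 g2 g3 g4 g5 gB; rewrite -gB G3r_dB_param// gB; congr (_ * _); field.
  by rewrite B0 g5.
have PF := @G3r_partial_fractions R _ _ _ _ _ _ _ _ B uA nA
  (HHx _ x1n l1n l2n be1) (HHx _ x2n (neq0_1D2 x2m) (neq0_2D x2m) be2)
  (HHx _ x3n (neq0_1D2 x3m) (neq0_2D x3m) be3) (HHx _ x4n (neq0_1D2 x4m) (neq0_2D x4m) be4)
  (HHBx _ x1n l1n l2n l3n al1n be1)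
  (HHBx _ x2n (neq0_1D2 x2m) (neq0_2D x2m) (neq0_1D x2m) (aln _ x2m x2n) be2)
  (HHBx _ x3n (neq0_1D2 x3m) (neq0_2D x3m) (neq0_1D x3m) (aln _ x3m x3n) be3)
  (HHBx _ x4n (neq0_1D2 x4m) (neq0_2D x4m) (neq0_1D x4m) (aln _ x4m x4n) be4).
have b1 : cabs (al x1) <= 2^-1 by rewrite al1; exact: hb.
have b2 : cabs (al x2) <= 2^-1 by apply: ha; exact: ea.
have b3 : cabs (al x3) <= 2^-1 by apply: ha; exact: ea.
have b4 : cabs (al x4) <= 2^-1 by apply: ha; exact: ea.
have g1 := cbm_geom b1; have g2 := cbm_geom b2; have g3 := cbm_geom b3; have g4 := cbm_geom b4.
(* With k_j = tau_j A_j / B, each term - k_j X / (1 - A_j X) equals (tau_j / B) (1 - 1 / (1 - A_j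
   X)). *)
transitivity (B * cavg (fun w =>
    (tau x1 + tau x2 + tau x3 + tau x4) / B
    + (- (tau x1 / B) * (1 - al x1 * X w)^-1 + (- (tau x2 / B) * (1 - al x2 * X w)^-1
    + (- (tau x3 / B) * (1 - al x3 * X w)^-1 + - (tau x4 / B) * (1 - al x4 * X w)^-1))))).
  congr (_ * cavg _); apply/funext => w; have [-> ->] := PF (X w).
  have := geomX_neq0 w b1; have := geomX_neq0 w b2; have := geomX_neq0 w b3; have := geomX_neq0 w b4.
  move: (al x1) (al x2) (al x3) (al x4) (tau x1) (tau x2) (tau x3) (tau x4) (X w) B0.
  clear; move: B => B a1 a2 a3 a4 t1 t2 t3 t4 z B0 m4 m3 m2 m1; field.
  by rewrite m1 m2 m3 m4 B0.
have [T1 T2] := sum_tau s1 s2 s3 s4 l3n (neq0_1D x2m) (neq0_1D x3m) (neq0_1D x4m).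
rewrite !cavgD ?cavgZ ?cavg_cst; try by cbm.
rewrite -!/(hypF _) (hT x2 (eT _ x2e)) (hT x3 (eT _ x3e)) (hT x4 (eT _ x4e)) be2 be3 be4 al1 T1.
have fB : hypF B = (1 + 2 * p) * hypF (be p) by apply: hT; exact: eT.
have t1E : tau x1 = 3 * (1 + p) ^+ 2 / (1 - p) ^+ 2.
  by rewrite /tau l3 /x1; field; rewrite pm p1.
have T3 : tau x2 * (1 + 2 * x2) + tau x3 * (1 + 2 * x3) + tau x4 * (1 + 2 * x4) =
    - 8 - tau x1 * (1 + 2 * x1) by rewrite -T2; ring.
rewrite [LHS](_ : _ = 4 - tau x1 * hypF (be p) - (tau x2 * (1 + 2 * x2) + tau x3 * (1 + 2 * x3) + tau x4 * (1 + 2 * x4)) * hypF B); last first.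
  by field.
rewrite T3 l1 t1E fB; field.
by rewrite p1 pm.
Qed.

End LogDerivative.

(** * Logarithmic identities recovered from their derivatives *)

Section LogIdentities.
Variable R : realType.
Notation C := R[i].
Notation Om := (R * R)%type.
Notation X := (@Xc R).
Notation Z := (@Zc R).
Implicit Types (x p B t v : C) (w : Om).

Definition logavg (f : Om -> C) : R := avg (fun w => ln (cabs (f w))).

Lemma Re_natM n (z : C) : complex.Re (n%:R * z) = n%:R * complex.Re z.
Proof. by rewrite -(rmorph_nat (@real_complex R)); case: z => a b /=; rewrite mul0r subr0. Qed.

(** For expansions whose linear terms cancel in a fixed combination. The integrals are abstracted to
    plain reals, so that linear arithmetic applies; the same holds for [quadratic_comb5]. *)
Lemma quadratic_comb2 (a1 a2 b1 b2 c1 c2 m1 m2 k : R) :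
  `|a1 - b1 - c1| <= m1 * k -> `|a2 - b2 - c2| <= m2 * k -> 2 * c1 - c2 = 0 ->
  `|2 * a1 - a2 - (2 * b1 - b2)| <= (2 * m1 + m2) * k.
Proof.
rewrite (_ : (2 * m1 + m2) * k = 2 * (m1 * k) + m2 * k); last by ring.
move: (m1 * k) (m2 * k) => n1 n2; rewrite !ler_norml.
by move=> /andP[? ?] /andP[? ?] ?; apply/andP; split; lra.
Qed.

Lemma quadratic_comb5 (a1 a2 a3 a4 a5 b1 b2 b3 b4 b5 c1 c2 c3 c4 c5 m1 m2 m3 m4 m5 k : R) :
  `|a5 - b5 - c5| <= m5 * k -> `|a4 - b4 - c4| <= m4 * k -> `|a3 - b3 - c3| <= m3 * k ->
  `|a2 - b2 - c2| <= m2 * k -> `|a1 - b1 - c1| <= m1 * k ->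
  c1 + 8 * c2 - 4 * c3 - 32 * c4 + 32 * c5 = 0 ->
  `|a1 + 8 * a2 - 4 * a3 - 32 * a4 + 32 * a5 - (b1 + 8 * b2 - 4 * b3 - 32 * b4 + 32 * b5)|
    <= (m1 + 8 * m2 + 4 * m3 + 32 * m4 + 32 * m5) * k.
Proof.
rewrite (_ : (m1 + 8 * m2 + 4 * m3 + 32 * m4 + 32 * m5) * k =
  m1 * k + 8 * (m2 * k) + 4 * (m3 * k) + 32 * (m4 * k) + 32 * (m5 * k)); last by ring.
move: (m1 * k) (m2 * k) (m3 * k) (m4 * k) (m5 * k) => n1 n2 n3 n4 n5.
rewrite !ler_norml.
by move=> /andP[? ?] /andP[? ?] /andP[? ?] /andP[? ?] /andP[? ?] ?; apply/andP; split; lra.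
Qed.

(** The difference of the two sides vanishes at v = 0, and its linear term vanishes by [cavg_Z_X].
    With v^2 = t it expresses [mu] through X. *)
Lemma logavg_Z_X : exists2 r : R, 0 < r & forall v, cabs v < r ->
  bounded_measurable (fun w => ln (cabs (1 + v * Z w))) /\
  2 * logavg (fun w => 1 + v * Z w) = logavg (fun w => 1 - v ^+ 2 * X w).
Proof.
have uZ : udiff (fun v w => 1 + v * Z w) (fun _ w => Z w).
  apply: udiff_ext (udiffD (udiff_cst 1) (udiffM (udiff_id R) (udiff_fun (cbm_Zc R)))) _.
  by exists 1 => // p w _; split; ring.
have uX : udiff (fun v w => 1 - v ^+ 2 * X w) (fun v w => - (2 * v * X w)).
  apply: (udiff_1subX (a := fun v => v ^+ 2) (a' := fun v => 2 * v)).
  by apply: udiff_ext (udiffM (udiff_id R) (udiff_id R)) _; exists 1 => // p w _; split; ring.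
have [|r1 [M1 [r10 n1 bm1 cb1 d1]]] := @udiff_ln R _ _ 1 uZ ltr01.
  by move=> w; rewrite mul0r addr0 cabs1.
have [|r2 [M2 [r20 n2 bm2 cb2 d2]]] := @udiff_ln R _ _ 1 uX ltr01.
  by move=> w; rewrite expr0n mul0r subr0 cabs1.
exists (Num.min (Num.min r1 r2) 8^-1); first by rewrite !lt_min r10 r20 invr_gt0/=.
move=> v vr; have := vr; rewrite !lt_min => /andP[/andP[v1 v2] _].
split; first exact: bm1.
apply/eqP; rewrite -subr_eq0; apply/eqP.
pose Phi u := 2 * logavg (fun w => 1 + u * Z w) - logavg (fun w => 1 - u ^+ 2 * X w).
have -> : 0 = Phi 0.
  have l1 (f : Om -> C) : f = (fun=> 1) -> logavg f = 0.
    by move=> ->; rewrite /logavg avg_cst cabs1 ln1.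
  rewrite /Phi !l1 ?mulr0 ?subr0//; apply/funext => w.
    by rewrite expr0n mul0r subr0.
  by rewrite mul0r addr0.
apply: (@cst_of_quadratic R Phi (Num.min (Num.min r1 r2) 8^-1) (2 * M1 + M2)) => // p q.
rewrite !lt_min => /andP[/andP[p1 p2] p8] /andP[/andP[q1 q2] q8] p0.
have h1 := d1 p q p1 q1; have h2 := d2 p q p2 q2.
have p2' : cabs p <= 2^-1 by lra.
have pp2 : cabs (p ^+ 2) <= 2^-1.
  by rewrite expr2; apply: le_trans (cabsM_le (ltW p8) (ltW p8)) _; lra.
have e : 2 * cavg (fun w => Z w / (1 + p * Z w)) - cavg (fun w => - (2 * p * X w) / (1 - p ^+ 2 * X w)) = 0.
  have gX := cbm_geom pp2; have gZ := cbm_geomZ p2'.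
  have h := cavg_Z_X (ltW p8); rewrite cavgD in h; [|by cbm|by cbm].
  have -> : cavg (fun w => - (2 * p * X w) / (1 - p ^+ 2 * X w)) =
      - 2 * cavg (fun w => p * X w / (1 - p ^+ 2 * X w)).
    by rewrite -cavgZ; [congr cavg; apply/funext => w; ring|cbm].
  by rewrite mulNr opprK -mulrDr h mulr0.
have e' : 2 * complex.Re ((q - p) * cavg (fun w => Z w / (1 + p * Z w)))
    - complex.Re ((q - p) * cavg (fun w => - (2 * p * X w) / (1 - p ^+ 2 * X w))) = 0.
  rewrite -(Re_natM 2) -Re_N -Re_D -[RHS](_ : complex.Re ((q - p) * 0) = 0); last by rewrite mulr0.
  by rewrite -e; congr complex.Re; ring.
exact: (quadratic_comb2 h1 h2 e').
Qed.

Lemma udiff_G3r : udiff (fun p w => G3r (X w) (al p)) (fun p w => G3r_dB (X w) (al p) * al' p).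
Proof.
have ux := udiff_fun (cbm_Xc R); have ua := udiff_al R; have uc c := @udiff_cst R c.
have uXB := udiffM ux ua.
have u1 := udiffD (uc 1) (udiffD (udiffM (uc 6) uXB) (udiffM uXB uXB)).
have u2 := udiffD (udiffM (uc 4) (udiffD ua ux)) (udiffM (uc (-3)) (udiffD uXB (uc 1))).
apply: udiff_ext (udiffD (udiffM u1 u1) (udiffM (uc (-16)) (udiffM uXB (udiffM u2 u2)))) _.
by exists 1 => // p w _; rewrite /G3r /G3r_dB; split; ring.
Qed.

Lemma logavg1 (f : Om -> C) : f = (fun=> 1) -> logavg f = 0.
Proof. by move=> ->; rewrite /logavg avg_cst cabs1 ln1. Qed.

Lemma cavg_1subX (A : C) : cabs A <= 2^-1 -> A * cavg (fun w => X w / (1 - A * X w)) = hypF A - 1.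
Proof.
move=> A2; have g := cbm_geom A2.
rewrite -cavgZ; last by cbm.
rewrite -[X in _ = _ - X](@cavg_cst R) -mulN1r -cavgZ; last by cbm.
rewrite /hypF -cavgD; [|by cbm|by cbm].
by congr cavg; apply/funext => w; field; exact: geomX_neq0.
Qed.

Lemma logavg_G3r : exists2 r : R, 0 < r & forall p, 0 < cabs p -> cabs p < r ->
  [/\ bounded_measurable (fun w => ln (cabs (G3r (X w) (al p)))),
      (forall w, G3r (X w) (al p) != 0) &
  logavg (fun w => G3r (X w) (al p)) + 8 * logavg (fun w => 1 - al p * X w)
    - 4 * logavg (fun w => 1 - be p * X w) = 32 * ln (cabs (1 + p / 2)) - 32 * ln (cabs (1 + 2 * p))].
Proof.
have [|r1 [M1 [r10 n1 bm1 cb1 d1]]] := @udiff_ln R _ _ 1 udiff_G3r ltr01.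
  by move=> w; rewrite al0 /G3r !(mulr0, mul0r, expr0n, addr0, subr0, expr1n) cabs1.
have [|r2 [M2 [r20 n2 bm2 _ d2]]] := @udiff_ln R _ _ 1 (udiff_1subX (udiff_al R)) ltr01.
  by move=> w; rewrite al0 mul0r subr0 cabs1.
have [|r3 [M3 [r30 n3 bm3 _ d3]]] := @udiff_ln R _ _ 1 (udiff_1subX (udiff_be R)) ltr01.
  by move=> w; rewrite be0 mul0r subr0 cabs1.
have [|r4 [M4 [r40 n4 bm4 _ d4]]] := @udiff_ln R _ _ 1 (udiff_lin 1 2^-1) ltr01.
  by move=> w; rewrite mulr0 addr0 cabs1.
have [|r5 [M5 [r50 n5 bm5 _ d5]]] := @udiff_ln R _ _ 1 (udiff_lin 1 2) ltr01.
  by move=> w; rewrite mulr0 addr0 cabs1.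
have [rk rk0 key] := cavg_log_derivative R.
have h2 : 0 < 2^-1 :> R by rewrite invr_gt0.
have [ra ra0 ha] := @al_small R _ h2.
have [rb rb0 hb] := @be_small R _ h2.
pose r := Num.min (Num.min (Num.min r1 r2) (Num.min r3 r4)) (Num.min (Num.min r5 rk) (Num.min (Num.min ra rb) 4^-1)).
have rP p : cabs p < r -> [/\ [/\ cabs p < r1, cabs p < r2, cabs p < r3, cabs p < r4 & cabs p < r5],
    cabs p < rk, cabs p < ra, cabs p < rb & cabs p < 4^-1].
  by rewrite /r !lt_min -!andbA => /and5P[-> -> -> -> /and5P[-> -> -> -> ->]].
exists r; first by rewrite /r !lt_min r10 r20 r30 r40 r50 rk0 ra0 rb0 invr_gt0/=.
move=> p p0 pr; have [[pr1 _ _ _ _] _ _ _ _] := rP p pr.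
split; [exact: bm1|by move=> w; exact: n1|].
pose Phi p := logavg (fun w => G3r (X w) (al p)) + 8 * logavg (fun w => 1 - al p * X w)
    - 4 * logavg (fun w => 1 - be p * X w) - 32 * logavg (fun _ => 1 + 2^-1 * p)
    + 32 * logavg (fun _ => 1 + 2 * p).
suff : Phi p = 0.
  rewrite /Phi /logavg !avg_cst (mulrC p 2^-1) => e.
  by apply/eqP; rewrite -subr_eq0 opprB addrA addrAC e.
have -> : 0 = Phi 0.
  rewrite /Phi !logavg1 ?(mulr0, subr0, addr0)//; apply/funext => w;
    by rewrite ?al0 ?be0 /G3r !(mulr0, mul0r, expr0n, addr0, subr0, expr1n).
apply: (@cst_of_quadratic R Phi r (M1 + 8 * M2 + 4 * M3 + 32 * M4 + 32 * M5)) => // {p0 pr pr1} {}p q.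
move=> /rP[[p1 p2 p3 p4 p5] pk pa pb p6] /rP[[q1 q2 q3 q4 q5] qk qa qb q6] p0.
have := d1 p q p1 q1; have := d2 p q p2 q2; have := d3 p q p3 q3.
have := d4 p q p4 q4; have := d5 p q p5 q5.
(* The numbering is reversed: [c1] belongs to 1 + 2 p, [c2] to 1 + p/2, [c3] to be p, [c4] to al p
   and [c5] to [G3r]. *)
set c1 := cavg _; set c2 := cavg _; set c3 := cavg _; set c4 := cavg _; set c5 := cavg _.
move=> b1 b2 b3 b4 b5.
have e : c5 + 8 * c4 - 4 * c3 - 32 * c2 + 32 * c1 = 0.
  have p1' := neq0_1D2 p6; have p2' := neq0_2D p6.
  have al_n : al p != 0 by rewrite /al !mulf_neq0 ?invr_eq0 ?expf_neq0.
  have be_n : be p != 0 by rewrite /be !mulf_neq0 ?invr_eq0 ?expf_neq0.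
  have scal (k A : C) : cabs A <= 2^-1 -> A != 0 ->
      cavg (fun w => - (k * X w) / (1 - A * X w)) = - k * (hypF A - 1) / A.
    move=> A2 A0; have g := cbm_geom A2.
    rewrite -(cavg_1subX A2) [RHS](_ : _ = - k * cavg (fun w => X w / (1 - A * X w))); last by field.
    rewrite -cavgZ; last by cbm.
    by congr cavg; apply/funext => w; rewrite mulrA (mulNr k).
  have E5 : c5 = al' p * (8 * hypF (al p) - 4 * (3 * (1 + p) ^+ 2 / (1 - p) ^+ 2) * hypF (be p) + 4) / al p.
    have al'_n : al' p != 0.
      by rewrite -cabs_gt0; apply: lt_le_trans (cabs_al'_ge p6); rewrite invr_gt0.
    have cE : cavg (fun w => G3r_dB (X w) (al p) / G3r (X w) (al p)) = (al' p)^-1 * c5.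
      rewrite /c5 -cavgZ; last exact: cb1.
      congr cavg; apply/funext => w; field.
      by rewrite n1.
    rewrite -key ?cabs_gt0// cE; field.
    by rewrite al_n.
  (* The values F(al p) cancel between [c5] and 8 [c4], and F(be p) between [c5] and 4 [c3], as 3 (1
     + p)^2 / (1 - p)^2 = (be' / be) / (al' / al). There remains 12 al' / al - 4 be' / be, the
     logarithmic derivative of al^12 / be^4 = ((2 + p) / (1 + 2 p))^32: hence the constant 32. *)
  rewrite E5 /c4 /c3 !scal//; try exact: ha; try exact: hb.
  rewrite /c2 /c1 !cavg_cst /al /be /al' /be'.
  have pm := neq0_1B p6.
  move: (hypF _) (hypF _) => f g; field.
  by rewrite p0 p1' p2' pm.
have e' : complex.Re ((q - p) * c5) + 8 * complex.Re ((q - p) * c4) - 4 * complex.Re ((q - p) * c3)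
    - 32 * complex.Re ((q - p) * c2) + 32 * complex.Re ((q - p) * c1) = 0.
  move: (c1) (c2) (c3) (c4) (c5) e => z1 z2 z3 z4 z5 e.
  rewrite -(Re_natM 8) -(Re_natM 4) -!(Re_natM 32) -!Re_N -!Re_D.
  rewrite -[RHS](_ : complex.Re ((q - p) * 0) = 0); last by rewrite mulr0.
  by rewrite -e; congr complex.Re; ring.
exact: (quadratic_comb5 b1 b2 b3 b4 b5 e').
Qed.

End LogIdentities.

(** * From averages back to Mahler measures *)

Section MahlerMeasures.
Variable R : realType.
Notation C := R[i].
Notation Om := (R * R)%type.
Notation X := (@Xc R).
Notation Z := (@Zc R).
Implicit Types (x p B t v : C) (w : Om).

Lemma mahler_logavg (P : C -> C -> C) (f : Om -> C) :
  (forall w, cabs (P (expi2pi w.1) (expi2pi w.2)) = cabs (f w)) ->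
  bounded_measurable (fun w => ln (cabs (f w))) -> mahler P = (logavg f)%:E.
Proof.
move=> Pf bf; apply: (etrans _ (avg_iterated bf)).
by apply: eq_integral => t1 _; apply: eq_integral => t2 _; rewrite (Pf (t1, t2)).
Qed.

Lemma expi2pi_add_inv (s : R) : expi2pi s + (expi2pi s)^-1 = (2 * ct s)%:C%C.
Proof.
rewrite /expi2pi /ct; have h : cos (2 * pi * s) ^+ 2 + sin (2 * pi * s) ^+ 2 = 1 := cos2Dsin2 _.
apply/eqP; rewrite eq_complex Re_D Im_D Re_V Im_V /= h !divr1.
by apply/andP; split; apply/eqP; ring.
Qed.

Lemma logavg_scale (k : C) (f : Om -> C) : k != 0 -> (forall w, f w != 0) ->
  bounded_measurable (fun w => ln (cabs (f w))) ->
  bounded_measurable (fun w => ln (cabs (k * f w))) /\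
  logavg (fun w => k * f w) = ln (cabs k) + logavg f.
Proof.
move=> k0 f0 bf.
have e w : ln (cabs (k * f w)) = ln (cabs k) + ln (cabs (f w)).
  by rewrite cabsM lnM// posrE cabs_gt0.
split; first by under eq_fun do rewrite e; apply: bmD => //; exact: bm_cst.
rewrite /logavg; under eq_fun do rewrite e.
by rewrite avgD// ?avg_cst//; exact: bm_cst.
Qed.

(** With v a square root of t, the Laurent polynomial is (4 / v) (1 + v Z) on the torus;
    [logavg_Z_X] then replaces v Z by v^2 X = t X. *)
Lemma mu_logavg : exists2 r : R, 0 < r & forall t, t != 0 -> cabs t < r ->
  mu t = (ln 4 - ln (cabs t) / 2 + logavg (fun w => 1 - t * X w) / 2)%:E.
Proof.
have [r r0 hr] := logavg_Z_X R.
pose s := Num.min r 2^-1; have s0 : 0 < s by rewrite lt_min r0 invr_gt0/=.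
exists (s ^+ 2); first by rewrite exprn_gt0.
move=> t t0 ts; set v := sqrtc t.
have v2 : v ^+ 2 = t by exact: sqr_sqrtc.
have vs : cabs v < s.
  by rewrite -(@ltr_pXn2r _ 2)// ?nnegrE ?cabs_ge0 ?(ltW s0)// -cabsX v2.
have vr : cabs v < r by move: vs; rewrite lt_min => /andP[].
have vh : cabs v <= 2^-1 by move: vs; rewrite lt_min => /andP[_ /ltW].
have [bz ez] := hr v vr; rewrite v2 in ez.
have v0 : v != 0 by apply/eqP => h; move: t0; rewrite -v2 h expr0n eqxx.
have k0 : 4 / v != 0 by rewrite mulf_neq0 ?invr_eq0 ?pnatr_eq0.
have [bk ek] := logavg_scale k0 (fun w => geomZ_neq0 w vh) bz.
rewrite /mu (@mahler_logavg _ (fun w => 4 / v * (1 + v * Z w)))//; last first.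
  move=> w; congr cabs; rewrite -/v.
  have Z4 : (2 * ct w.1)%:C%C + (2 * ct w.2)%:C%C = 4 * Z w :> C.
    rewrite -(rmorph_nat (@real_complex R)) -rmorphD -rmorphM /Zr; congr (_%:C%C).
    by field.
  rewrite -addrA expi2pi_add_inv -!addrA (addrA (expi2pi w.1)) expi2pi_add_inv Z4; field.
  exact: v0.
rewrite ek; congr (_%:E).
have -> : ln (cabs (4 / v)) = ln 4 - ln (cabs v).
  by rewrite cabsM cabsV cabs_nat ln_div ?posrE ?cabs_gt0.
have -> : ln (cabs t) = 2 * ln (cabs v).
  by rewrite -v2 cabsX lnXn ?cabs_gt0// mulr_natl.
by rewrite -ez; field.
Qed.

Lemma G3_G3r (a B : C) : B != 0 -> G3 a B^-1 = (B ^+ 4)^-1 * G3r a B.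
Proof. by move=> B0; rewrite /G3 /G3r; field. Qed.

(** The second argument of [G3] is 1 / al p, so [G3] is (al p)^-4 times [G3r]; that factor accounts
    for the term - 4 log|al p|. *)
Lemma mahler_G3 : exists2 r : R, 0 < r & forall p, 0 < cabs p -> cabs p < r ->
  mahler (fun x y : C => G3 ((x + x^-1) ^+ 2 * (y + y^-1) ^+ 2 / 16) (p^-1 * ((1 + 2 * p) / (2 + p)) ^+ 3))
  = (- 4 * ln (cabs (al p)) + 32 * ln (cabs (1 + p / 2)) - 32 * ln (cabs (1 + 2 * p))
     - 8 * logavg (fun w => 1 - al p * X w) + 4 * logavg (fun w => 1 - be p * X w))%:E.
Proof.
have [r r0 hr] := logavg_G3r R.
exists (Num.min r 4^-1); first by rewrite lt_min r0 invr_gt0/=.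
move=> p p0; rewrite lt_min => /andP[pr p4]; have [bm nz e] := hr p p0 pr.
have p1 := neq0_1D2 p4; have p2 := neq0_2D p4.
have pn0 : p != 0 by rewrite -cabs_gt0.
have al_n : al p != 0 by rewrite /al !mulf_neq0 ?invr_eq0 ?expf_neq0.
have k0 : (al p ^+ 4)^-1 != 0 by rewrite invr_eq0 expf_neq0.
have [bk ek] := logavg_scale k0 nz bm.
rewrite (@mahler_logavg _ (fun w => (al p ^+ 4)^-1 * G3r (X w) (al p)))//; last first.
  move=> w; congr cabs; rewrite -G3_G3r//; congr G3.
    rewrite !expi2pi_add_inv /Xc /Xr -!rmorphXn -rmorphM -(rmorph_nat (@real_complex R)) -fmorphV -rmorphM.
    by congr (_%:C%C); field.
  by rewrite /al; field; rewrite pn0 p1 p2.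
rewrite ek; congr (_%:E).
rewrite cabsV cabsX lnV ?posrE ?exprn_gt0 ?cabs_gt0// lnXn ?cabs_gt0//.
move: e; move: (logavg _) (logavg _) (logavg _) => l1 l2 l3 e.
rewrite -mulr_natl; lra.
Qed.

End MahlerMeasures.

(* Comparison of the elementary logarithms in p, 2 + p, 1 + 2 p and 2 *)
Local Close Scope classical_set_scope.

Theorem mainTheorem11 (R : realType) :
  exists eps : R, 0 < eps /\
  forall p : R[i], 0 < cabs p < eps ->
    mahler (fun x y : R[i] =>
      G3 ((x + x^-1) ^+ 2 * (y + y^-1) ^+ 2 / 16)
         (p^-1 * ((1 + 2 * p) / (2 + p)) ^+ 3))
    = ((- (16 * ln 2))%R%:E
       - 16%:E * mu (p * ((2 + p) / (1 + 2 * p)) ^+ 3)%R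
       + 8%:E * mu (p ^+ 3 * ((2 + p) / (1 + 2 * p)))%R)%E.
Proof.
have [r1 r10 hG] := mahler_G3 R.
have [r2 r20 hmu] := mu_logavg R.
(* Half the radius, since [al_small] and [be_small] give a weak inequality where [mu_logavg] asks
   for a strict one. *)
have r22 : 0 < r2 / 2 by rewrite divr_gt0.
have [ra ra0 ha] := @al_small R _ r22.
have [rb rb0 hb] := @be_small R _ r22.
exists (Num.min (Num.min r1 4^-1) (Num.min ra rb)).
split; first by rewrite !lt_min r10 ra0 rb0 invr_gt0 ltr0n.
move=> p; rewrite !lt_min => /andP[p0 /andP[/andP[p1 p4] /andP[pa pb]]].
have n1 := neq0_1D2 p4; have n2 := neq0_2D p4.
have pn0 : p != 0 by rewrite -cabs_gt0.
have alE : p * ((2 + p) / (1 + 2 * p)) ^+ 3 = al p by rewrite /al; field.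
have beE : p ^+ 3 * ((2 + p) / (1 + 2 * p)) = be p by rewrite /be; field.
have al_n : al p != 0 by rewrite /al !mulf_neq0 ?invr_eq0 ?expf_neq0.
have be_n : be p != 0 by rewrite /be !mulf_neq0 ?invr_eq0 ?expf_neq0.
have half : r2 / 2 < r2 by rewrite ltr_pdivrMr// ltr_pMr// ltr1n.
rewrite alE beE hG// !hmu//; try by [apply: le_lt_trans half; exact: ha|apply: le_lt_trans half; exact: hb].
have EE (a b c : R) : (a%:E - 16%:E * b%:E + 8%:E * c%:E = (a - 16 * b + 8 * c)%:E)%E by [].
rewrite EE; congr (_%:E).
have q1 : 0 < cabs (1 + 2 * p) by rewrite cabs_gt0.
have q2 : 0 < cabs (2 + p) by rewrite cabs_gt0.
have q0 : 0 < cabs p by [].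
have lal : ln (cabs (al p)) = ln (cabs p) + 3 * ln (cabs (2 + p)) - 3 * ln (cabs (1 + 2 * p)).
  rewrite /al cabsM cabsV cabsM !cabsX ln_div ?posrE ?mulr_gt0 ?exprn_gt0//.
  by rewrite lnM ?posrE ?exprn_gt0// (lnXn 3 q2) (lnXn 3 q1); ring.
have lbe : ln (cabs (be p)) = 3 * ln (cabs p) + ln (cabs (2 + p)) - ln (cabs (1 + 2 * p)).
  rewrite /be cabsM cabsV cabsM cabsX ln_div ?posrE ?mulr_gt0 ?exprn_gt0//.
  by rewrite lnM ?posrE ?exprn_gt0// (lnXn 3 q0); ring.
have lh : ln (cabs (1 + p / 2)) = ln (cabs (2 + p)) - ln 2.
  rewrite (_ : 1 + p / 2 = (2 + p) / 2); last by field.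
  by rewrite cabsM cabsV cabs_nat ln_div ?posrE.
have l4 : ln 4 = 2 * ln 2 :> R.
  by rewrite (_ : 4 = 2 ^+ 2 :> R) ?lnXn ?mulr_natl// -natrX.
rewrite lal lbe lh l4.
move: (logavg _) (logavg _) (ln _) (ln _) (ln _) (ln _) => a b c d e f.
lra.
Qed.
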